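(* Let $X,X_1,\dots,X_m$ be i.i.d. with distribution function $F$ on $\mathbb R$ and $Y,Y_1,\dots,Y_n$ be i.i.d. with distribution function $G$ on $\mathbb R$, the two samples being independent, and let $F_m(x)=\frac1m\sum_{i=1}^m 1_{\{X_i\le x\}}$ and $G_n(x)=\frac1n\sum_{i=1}^n1_{\{Y_i\le x\}}$ be the empirical distribution functions of the two samples, so that $W_{m,n}=\int F_m\,dG_n$ is the Wilcoxon statistic. Assume that $m/(m+n)\to\lambda\in(0,1)$ as $m,n\to\infty$. Then $$\left\{\frac{\sqrt{mn/(m+n)}}{a(mn/(m+n))}\left(\int F_m\,dG_n-\int F\,dG\right),\ n\ge1\right\}$$ satisfies the large deviation principle in $\mathbb R$ with speed $a^2(mn/(m+n))$ and rate function $I^W$ defined by $$I^W(x)=\frac{x^2}{2\bigl(\lambda\operatorname{Var}(F(Y))+(1-\lambda)\operatorname{Var}(G(X))\bigr)}.$$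
   Context: $a:(0,\infty)\to(0,\infty)$ is a function with $a(t)\to\infty$ and $a(t)/\sqrt t\to0$ as $t\to\infty$; $m=m(n)$. If the denominator in $I^W$ is $0$, read $I^W(0)=0$ and $I^W(x)=+\infty$ for $x\ne0$. Large deviation principle (LDP). Let $\mathcal X$ be a metric space, $\lambda(n)$ positive numbers with $\lambda(n)\to+\infty$, and $Z_n$ maps from probability spaces $(\Omega_n,\mathcal F_n,P_n)$ to $\mathcal X$. A rate function is a map $I:\mathcal X\to[0,+\infty]$ such that $\{I\le L\}$ is compact for every $L\in\mathbb R$. $\{Z_n\}$ satisfies the LDP with speed $\lambda(n)$ and rate function $I$ if $\liminf_n\frac1{\lambda(n)}\log P_{n*}(Z_n\in U)\ge-\inf_UI$ for every open measurable $U$ and $\limsup_n\frac1{\lambda(n)}\log P_n^*(Z_n\in C)\le-\inf_CI$ for every closed measurable $C$, where $P_{n*}$ and $P_n^*$ are inner and outer probability ($\inf\emptyset=+\infty$, $\log0=-\infty$).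
   Formalization: The printed rate function is proved when F and G have no common discontinuity; for arbitrary F and G the principle is proved with Var(G(X-)), the left limit of G, in place of Var(G(X)), since the printed formula fails when X and Y share atoms (e.g. Bernoulli samples). *)

(* Defs.v *)
From HB Require Import structures.
From mathcomp Require Import all_boot all_order all_algebra.
From mathcomp Require Import all_classical all_reals all_analysis.

Set Implicit Arguments.
Unset Strict Implicit.
Unset Printing Implicit Defensive.
Import Order.TTheory GRing.Theory Num.Theory.
Import numFieldNormedType.Exports.

Local Open Scope classical_set_scope.
Local Open Scope ring_scope.

(* The library's outer measures are built from countable covers; these are the
   elementary inner and outer probabilities of an arbitrary event. *)
Definition outer_prob {R : realType} {d : measure_display}
    {T : measurableType d} (P : probability T R) (A : set T) : \bar R :=
  ereal_inf [set P B | B in [set B | measurable B /\ A `<=` B]].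

Definition inner_prob {R : realType} {d : measure_display}
    {T : measurableType d} (P : probability T R) (A : set T) : \bar R :=
  ereal_sup [set P B | B in [set B | measurable B /\ B `<=` A]].

Definition rate_function {R : realType} {S : metricType R}
    (I : S -> \bar R) : Prop :=
  (forall x, (0 <= I x)%E) /\
  (forall L : R, compact [set x | (I x <= L%:E)%E]).

(* Sequences are indexed by n >= 1, so nothing is required of [speed 0].
   [Sigma] is the sigma-algebra with which the metric space [S] is equipped. *)
Definition LDP {R : realType} {S : metricType R} (Sigma : set (set S))
    {d : nat -> measure_display} {T : forall n, measurableType (d n)}
    (P : forall n, probability (T n) R) (Z : forall n, T n -> S)
    (speed : nat -> R) (I : S -> \bar R) : Prop :=
  [/\ (forall n, (0 < n)%N -> 0 < speed n) /\
        speed n @[n --> \oo] --> +oo,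
      rate_function I,
      forall U : set S, open U -> Sigma U ->
        (- ereal_inf (I @` U) <=
         limn_einf (fun n =>
           (speed n)^-1%:E * lne (inner_prob (P n) (Z n @^-1` U))))%E
    & forall C : set S, closed C -> Sigma C ->
        (limn_esup (fun n =>
           (speed n)^-1%:E * lne (outer_prob (P n) (Z n @^-1` C))) <=
         - ereal_inf (I @` C))%E].

Section independence.
Context {R : realType} {d : measure_display} {T : measurableType d}.
Variable P : probability T R.

Definition mutually_independent {I : finType}
    (X : I -> {RV P >-> R}) : Prop :=
  forall (J : {set I}) (A : I -> set R), (forall i, measurable (A i)) ->
    P (\bigcap_(i in [set` J]) (X i @^-1` A i)) =
    (\prod_(i in J) P (X i @^-1` A i))%E.

Definition iid_with_cdf {I : finType}
    (X : I -> {RV P >-> R}) (F : R -> R) : Prop :=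
  mutually_independent X /\ (forall i x, cdf (X i) x = (F x)%:E).

Definition sigma_generated {I : finType}
    (X : I -> {RV P >-> R}) : set (set T) :=
  <<s [set B | exists i A, measurable A /\ B = X i @^-1` A] >>.

Definition independent_samples {I J : finType}
    (X : I -> {RV P >-> R}) (Y : J -> {RV P >-> R}) : Prop :=
  forall A B, sigma_generated X A -> sigma_generated Y B ->
    P (A `&` B) = (P A * P B)%E.

End independence.

Section empirical_cdf.
Context {R : realType} {n : nat}.
Variable x : 'I_n -> R.

Definition ecdf (t : R) : R := n%:R^-1 * \sum_(i < n) (x i <= t)%R%:R.

Lemma ecdf_nondecreasing : nondecreasing ecdf.
Proof.
move=> s t st; rewrite /ecdf ler_wpM2l ?invr_ge0//.
apply: ler_sum => i _; rewrite ler_nat.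
by case: (leP (x i) s) => // /le_trans -> //.
Qed.

Lemma ecdf_right_continuous : right_continuous ecdf.
Proof.
move=> t; apply: cvgM; first exact: cvg_cst.
apply: cvg_big => [|i _]; first exact: add_continuous.
have [xit|xit] := leP (x i) t.
  apply: cvg_near_cst; near=> s.
  have ts : t < s by near: s; exact: nbhs_right_gt.
  by rewrite (le_trans xit (ltW ts)).
apply: cvg_near_cst; near=> s.
have sx : s < x i by near: s; exact: nbhs_right_lt.
by rewrite leNgt sx.
Unshelve. all: by end_near. Qed.

HB.instance Definition _ := isCumulative.Build R _ R ecdf
  ecdf_nondecreasing ecdf_right_continuous.

End empirical_cdf.

Definition stieltjes {R : realType} (f : R -> R) (g : cumulative R R) : R :=
  (\int[lebesgue_stieltjes_measure g]_x f x)%R.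

(* Projecting the kernel 1_{x <= y} onto its first argument gives
   E 1_{x <= Y} = P (x <= Y) = 1 - g (x-) when g is the cdf of Y. It can be
   replaced by 1 - g x only if the law of X does not charge the jumps of g. *)
Definition left_limit {R : realType} (g : R -> R) (x : R) : R :=
  lim (g y @[y --> x^'-]).

(* The rate x^2 / (2 s) with s = lambda * vY + (1 - lambda) * vX, where the
   degenerate case s = 0 gives the indicator-type rate concentrated at 0. *)
Definition wilcoxon_rate {R : realType} (lambda vY vX x : R) : \bar R :=
  let D := 2 * (lambda * vY + (1 - lambda) * vX) in
  if D == 0 then (if x == 0 then 0%E else +oo%E) else (x ^+ 2 / D)%:E.

(* Main.v *)
Require Import Defs.
From HB Require Import structures.
From mathcomp Require Import all_boot all_order all_algebra.
From mathcomp Require Import all_classical all_reals all_analysis.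
From mathcomp Require Import measurable_realfun ring lra.

Set Implicit Arguments.
Unset Strict Implicit.
Unset Printing Implicit Defensive.
Import Order.TTheory GRing.Theory Num.Theory.
Import numFieldNormedType.Exports.

Local Open Scope classical_set_scope.
Local Open Scope ring_scope.

(** The Wilcoxon statistic [W] is the average of the kernel [h (x, y)], the
    indicator of [x <= y], over all pairs from the two samples. With
    [h1 x = E h (x, Y)], [h2 y = E h (X, y)] and [theta = E W], Hoeffding's
    decomposition ([hoeffding_decomposition]) writes [W - theta] as the sum of
    the averages of [h1 (X_i) - theta] and of [h2 (Y_j) - theta], plus the
    average [U] of a kernel that is centred in each variable separately. Here
    [h2 = F] and [h1 x = 1 - G (x-)], so the variances of the two projections
    are those of [F (Y)] and [G (X-)].

    Let [N = m n / (m + n)], [s = a (N) ^ 2], and let [Z] be the normalized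
    statistic. The logarithm of [E exp (s t Z)], divided by [s], converges to
    [t ^ 2 / 2] times [lambda Var h2 (Y) + (1 - lambda) Var h1 (X)], for two
    reasons.

    - For the two independent averages, the moment generating function is a
      product over the observations, each evaluated at an argument of order
      [a (N) / sqrt N], which tends to 0: only the second-order expansion
      matters, and the cubic error is negligible after division by [s]
      ([ln_mgf_centered], [ln_mgf_sums]).

    - The degenerate part is negligible: [E exp (s' U)] stays bounded as long as
      [s' ^ 2] is at most a constant times [m n] ([Ex_expR_degenerate]), whereas
      here [s'] is of order [a (N) sqrt N], which is much smaller than [N], and
      [N ^ 2 <= m n].
      The bound rests on [exp x <= x + exp (2 x ^ 2)], which replaces a centred
      exponent by its square. Given the first sample this is applied to every
      observation of the second one; what remains is the exponential moment of
      the square of a centred sum over the first sample, and it is computed by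
      removing the summands one at a time ([Ex_expR_sqr_sum]). The degenerate
      part is then discarded by convexity of logarithmic moment generating
      functions ([ln_mgf_convex], [ln_mgf_ustat]).

    A quadratic limit of the normalized cumulants implies the large deviation
    principle with the conjugate quadratic rate ([LDP_of_cumulant]): the upper
    bound is Chernoff's inequality, the lower bound is exponential tilting, and
    both remain valid when the limiting variance vanishes.

    Every independence statement is used in the form of [Ex_decouple]: the
    expectation of a function of an independent pair is an iterated integral
    over two copies of the same probability space. Finally, when [F] and [G]
    have no common discontinuity, [X] almost surely avoids the countably many
    atoms of [Y], so that [G (X-) = G (X)] ([left_limit_ae_eq]). *)

(** * Expectations of bounded measurable functions *)

(** All the functions integrated below are bounded: their integrals are real
    numbers, linear and monotone without any integrability condition. *)
Definition bmeas {R : realType} {d : measure_display} {T : measurableType d}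
    (f : T -> R) : Prop :=
  measurable_fun [set: T] f /\ exists c, forall x, `|f x| <= c.

Section bmeas_closure.
Context {R : realType} {d : measure_display} {T : measurableType d}.
Implicit Types f g : T -> R.

Lemma bmeas_cst (c : R) : bmeas (fun _ : T => c).
Proof. by split; [exact: measurable_cst|exists `|c|]. Qed.

Lemma bmeasD f g : bmeas f -> bmeas g -> bmeas (fun x => f x + g x).
Proof.
move=> [mf [c fc]] [mg [c' gc]]; split; first exact: measurable_funD.
by exists (c + c') => x; rewrite (le_trans (ler_normD _ _))// lerD.
Qed.

Lemma bmeasM f g : bmeas f -> bmeas g -> bmeas (fun x => f x * g x).
Proof.
move=> [mf [c fc]] [mg [c' gc]]; split; first exact: measurable_funM.
by exists (c * c') => x; rewrite normrM ler_pM.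
Qed.

Lemma bmeasZ c f : bmeas f -> bmeas (fun x => c * f x).
Proof. by apply: bmeasM; exact: bmeas_cst. Qed.

Lemma bmeasN f : bmeas f -> bmeas (fun x => - f x).
Proof.
move=> [mf [c fc]]; split; first exact: measurable_funN.
by exists c => x; rewrite normrN.
Qed.

Lemma bmeasB f g : bmeas f -> bmeas g -> bmeas (fun x => f x - g x).
Proof. by move=> bf bg; apply: bmeasD => //; exact: bmeasN. Qed.

Lemma bmeasX f n : bmeas f -> bmeas (fun x => f x ^+ n).
Proof.
move=> bf; elim: n => [|n IHn].
  by rewrite (_ : (fun _ => _) = fun=> 1) ?funeqE//; exact: bmeas_cst.
rewrite (_ : (fun _ => _) = fun x => f x * f x ^+ n); first exact: bmeasM.
by apply/funext => x; rewrite exprS.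
Qed.

Lemma bmeas_expR f : bmeas f -> bmeas (fun x => expR (f x)).
Proof.
move=> [mf [c fc]]; split; first exact: measurableT_comp.
exists (expR c) => x; rewrite ger0_norm ?expR_ge0// ler_expR.
by rewrite (le_trans (ler_norm _)).
Qed.

Lemma bmeas_sum (I : Type) (s : seq I) (P : pred I) (f : I -> T -> R) :
  (forall i, P i -> bmeas (f i)) ->
  bmeas (fun x => \sum_(i <- s | P i) f i x).
Proof.
move=> bf; elim: s => [|i s IHs].
  under eq_fun do rewrite big_nil; exact: bmeas_cst.
under eq_fun do rewrite big_cons; have [Pi|//] := boolP (P i).
by apply: bmeasD => //; exact: bf.
Qed.

Lemma bmeas_prod (I : Type) (s : seq I) (P : pred I) (f : I -> T -> R) :
  (forall i, P i -> bmeas (f i)) ->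
  bmeas (fun x => \prod_(i <- s | P i) f i x).
Proof.
move=> bf; elim: s => [|i s IHs].
  under eq_fun do rewrite big_nil; exact: bmeas_cst.
under eq_fun do rewrite big_cons; have [Pi|//] := boolP (P i).
by apply: bmeasM => //; exact: bf.
Qed.

Lemma bmeas_natr (b : T -> bool) :
  measurable_fun [set: T] b -> bmeas (fun x => (b x)%:R : R).
Proof.
move=> mb; split; last by exists 1 => x; case: (b x); rewrite /= ?normr0 ?normr1.
have -> : (fun x => (b x)%:R : R) = \1_(b @^-1` [set true]).
  apply/funext => x; rewrite indicE; congr (_%:R); case: (boolP (b x)) => bx.
    by rewrite mem_set.
  by rewrite memNset//=; exact/negP.
apply: measurable_indic; rewrite -(setTI (b @^-1` _)); exact: mb.
Qed.

End bmeas_closure.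

Lemma bmeas_comp {R : realType} {d d' : measure_display}
    {T : measurableType d} {U : measurableType d'} (f : U -> R) (g : T -> U) :
  bmeas f -> measurable_fun [set: T] g -> bmeas (fun x => f (g x)).
Proof.
move=> [mf [c fc]] mg; split; first exact: measurableT_comp.
by exists c => x; exact: fc.
Qed.

Lemma bmeas_comp_mfun {R : realType} {d d' : measure_display}
    {T : measurableType d} {U : measurableType d'} (f : U -> R)
    (g : {mfun T >-> U}) :
  bmeas f -> bmeas (fun x => f (g x)).
Proof. by move=> bf; apply: bmeas_comp. Qed.

Section expectation_bmeas.
Context {R : realType} {d : measure_display} {T : measurableType d}.
Variable P : probability T R.
Implicit Types f g : T -> R.

Lemma bmeas_integrable f : bmeas f -> P.-integrable [set: T] (EFin \o f).
Proof.
move=> [mf [c fc]]; apply: measurable_bounded_integrable => //.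
  by rewrite (le_lt_trans (probability_le1 P measurableT))// ltry.
exists c; split; first by rewrite num_real.
by move=> M cM x _ /=; rewrite (le_trans (fc x))// ltW.
Qed.

Lemma bmeas_integralE f : bmeas f ->
  (\int[P]_x (f x)%:E)%E = (\int[P]_x f x)%R%:E.
Proof.
by move=> bf; rewrite /Rintegral fineK// integrable_fin_num//; exact: bmeas_integrable.
Qed.

Lemma ExD f g : bmeas f -> bmeas g ->
  \int[P]_x (f x + g x) = \int[P]_x f x + \int[P]_x g x.
Proof. by move=> bf bg; apply: RintegralD => //; exact: bmeas_integrable. Qed.

Lemma ExB f g : bmeas f -> bmeas g ->
  \int[P]_x (f x - g x) = \int[P]_x f x - \int[P]_x g x.
Proof. by move=> bf bg; apply: RintegralB => //; exact: bmeas_integrable. Qed.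

Lemma ExZ c f : bmeas f -> \int[P]_x (c * f x) = c * \int[P]_x f x.
Proof. by move=> bf; apply: RintegralZl => //; exact: bmeas_integrable. Qed.

Lemma Ex_cst (c : R) : \int[P]_x c = c.
Proof. by rewrite Rintegral_cst//= probability_setT mulr1. Qed.

Lemma Ex_le f g : bmeas f -> bmeas g -> (forall x, f x <= g x) ->
  \int[P]_x f x <= \int[P]_x g x.
Proof. by move=> bf bg fg; apply: le_Rintegral => //; exact: bmeas_integrable. Qed.

Lemma Ex_ge c f : bmeas f -> (forall x, c <= f x) -> c <= \int[P]_x f x.
Proof. by move=> bf cf; rewrite -[leLHS]Ex_cst; apply: Ex_le => //; exact: bmeas_cst. Qed.

Lemma Ex_le_cst c f : bmeas f -> (forall x, f x <= c) -> \int[P]_x f x <= c.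
Proof. by move=> bf cf; rewrite -[leRHS]Ex_cst; apply: Ex_le => //; exact: bmeas_cst. Qed.

Lemma Ex_norm_le c f : bmeas f -> (forall x, `|f x| <= c) -> `|\int[P]_x f x| <= c.
Proof.
move=> bf fc; rewrite ler_norml; apply/andP; split.
  by apply: Ex_ge => // x; have := fc x; rewrite ler_norml => /andP[].
by apply: Ex_le_cst => // x; have := fc x; rewrite ler_norml => /andP[].
Qed.

Lemma Ex_expR_gt0 f : bmeas f -> 0 < \int[P]_x expR (f x).
Proof.
move=> [mf [c fc]]; apply: (@lt_le_trans _ _ (expR (- c))); first exact: expR_gt0.
apply: Ex_ge => [|x]; first by apply: bmeas_expR; split => //; exists c.
by rewrite ler_expR; have := fc x; rewrite ler_norml => /andP[].
Qed.

Lemma Ex_sum (I : Type) (s : seq I) (Q : pred I) (f : I -> T -> R) :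
  (forall i, bmeas (f i)) ->
  \int[P]_x (\sum_(i <- s | Q i) f i x) = \sum_(i <- s | Q i) \int[P]_x f i x.
Proof.
move=> bf; elim: s => [|i s IHs].
  under eq_Rintegral do rewrite big_nil; by rewrite Ex_cst big_nil.
under eq_Rintegral do rewrite big_cons; rewrite big_cons; have [Qi|//] := boolP (Q i).
by rewrite ExD ?IHs//; exact: bmeas_sum.
Qed.

Lemma Ex_indic (A : set T) : measurable A -> \int[P]_x (\1_A x) = fine (P A).
Proof. by move=> mA; rewrite /Rintegral integral_indic// setIT. Qed.

End expectation_bmeas.

Section fubini_bmeas.
Context {R : realType} {d1 d2 : measure_display}.
Context {T1 : measurableType d1} {T2 : measurableType d2}.
Variables (P1 : probability T1 R) (P2 : probability T2 R).
Variable f : T1 * T2 -> R.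
Hypothesis bf : bmeas f.
Hypothesis f0 : forall x, 0 <= f x.

Lemma bmeas_sectionl x : bmeas (fun y => f (x, y)).
Proof. by apply: (bmeas_comp bf); exact: measurable_fun_pair. Qed.

Lemma bmeas_sectionr y : bmeas (fun x => f (x, y)).
Proof. by apply: (bmeas_comp bf); exact: measurable_fun_pair. Qed.

Lemma bmeas_Exl : bmeas (fun x => \int[P2]_y f (x, y)).
Proof.
case: (bf) => mf [c fc]; split.
  apply/measurable_EFinP.
  have -> : EFin \o (fun x => (\int[P2]_y f (x, y))%R)
          = fubini_F P2 (EFin \o f).
    apply/funext => x /=; rewrite /fubini_F/=.
    by rewrite -bmeas_integralE//; exact: bmeas_sectionl.
  apply: measurable_fun_fubini_tonelli_F; first exact/measurable_EFinP.
  by move=> x /=; rewrite lee_fin.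
by exists c => x; apply: Ex_norm_le => //; exact: bmeas_sectionl.
Qed.

Lemma Ex_prodl :
  \int[P1]_x \int[P2]_y f (x, y) = fine (\int[(P1 \x P2)%E]_z (f z)%:E)%E.
Proof.
have mf : measurable_fun [set: T1 * T2] (EFin \o f).
  by apply/measurable_EFinP; case: bf.
rewrite (fubini_tonelli1 (EFin \o f))//=.
rewrite /Rintegral; congr fine; apply: eq_integral => x _.
by rewrite /fubini_F/= bmeas_integralE//; exact: bmeas_sectionl.
Qed.

End fubini_bmeas.

Lemma Ex_swap {R : realType} {d1 d2 : measure_display}
    {T1 : measurableType d1} {T2 : measurableType d2}
    (P1 : probability T1 R) (P2 : probability T2 R) (f : T1 * T2 -> R) :
  bmeas f -> (forall x, 0 <= f x) ->
  \int[P1]_x \int[P2]_y f (x, y) = \int[P2]_y \int[P1]_x f (x, y).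
Proof.
move=> bf f0.
have mf : measurable_fun [set: T1 * T2] (EFin \o f).
  by apply/measurable_EFinP; case: bf.
rewrite Ex_prodl// (fubini_tonelli2 (EFin \o f))//=.
rewrite /Rintegral; congr fine; apply: eq_integral => y _.
by rewrite /fubini_G/= bmeas_integralE//; exact: bmeas_sectionr.
Qed.

(** * Independence and decoupling *)

Section decoupling.
Context {R : realType} {d d1 d2 : measure_display}.
Context {T : measurableType d} {U1 : measurableType d1} {U2 : measurableType d2}.
Variables (P : probability T R) (xi : {mfun T >-> U1}) (eta : {mfun T >-> U2}).
Hypothesis indep : forall A B, measurable A -> measurable B ->
  P (xi @^-1` A `&` eta @^-1` B) = (P (xi @^-1` A) * P (eta @^-1` B))%E.

Let joint (w : T) : U1 * U2 := (xi w, eta w).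

Let measurable_joint : measurable_fun [set: T] joint.
Proof. exact: measurable_fun_pair. Qed.

HB.instance Definition _ := isMeasurableFun.Build _ _ _ _ joint measurable_joint.

(** The joint law is the product of the marginal laws, which agree on
    rectangles; both marginals are then pulled back to the same space [T], and
    no product of sample spaces has to be constructed. *)
Lemma Ex_decouple (f : U1 * U2 -> R) : bmeas f -> (forall x, 0 <= f x) ->
  \int[P]_w f (xi w, eta w) = \int[P]_w \int[P]_v f (xi w, eta v).
Proof.
move=> bf f0.
have mf : measurable_fun [set: U1 * U2] (EFin \o f).
  by apply/measurable_EFinP; case: bf.
have f0' z : (0 <= (EFin \o f) z)%E by rewrite lee_fin.
transitivity (fine (\int[distribution P joint]_z (f z)%:E)%E).
  by rewrite /Rintegral (ge0_integral_distribution joint mf f0').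
rewrite (eq_measure_integral (distribution P xi \x distribution P eta)%E); last first.
  move=> /= A mA _; apply/esym.
  apply: (@product_measure_unique _ _ _ _ _ (distribution P xi)
    (distribution P eta) (distribution P joint))  => //.
transitivity (\int[distribution P xi]_x \int[distribution P eta]_y f (x, y)).
  by rewrite Ex_prodl.
rewrite /Rintegral (ge0_integral_distribution xi
  (f := fun x => (fine (\int[distribution P eta]_y (f (x, y))%:E))%:E)).
- congr fine; apply: eq_integral => w _ /=.
  rewrite (ge0_integral_distribution eta (f := fun y => (f (xi w, y))%:E))//=.
    by apply/measurable_EFinP; case: (bmeas_sectionl bf (xi w)).
  by move=> y; rewrite lee_fin.
- by apply/measurable_EFinP; case: (bmeas_Exl (distribution P eta) bf f0).
- by move=> x; rewrite lee_fin; apply: Rintegral_ge0.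
Qed.

End decoupling.

Lemma finset_ind (I : finType) (Q : {set I} -> Prop) :
  Q finset.set0 -> (forall k (J : {set I}), k \notin J -> Q J -> Q (k |: J)%SET) ->
  forall J, Q J.
Proof.
move=> Q0 QU J; have [n] := ubnP #|J|; elim: n J => // n IHn J.
have [->//|[k kJ]] := set_0Vmem J; rewrite (cardsD1 k) kJ => ltJn.
by rewrite -(finset.setD1K kJ); apply: QU; rewrite ?finset.setD11//; exact: IHn.
Qed.

Section sub_sigma_algebra.
Context {R : realType} {d : measure_display} {T : measurableType d}.
Variables (P : probability T R) (I : finType) (X : I -> {RV P >-> R}).

(** The cylinders over the coordinates in [J]: a pi-system generating the
    sigma-algebra of the subfamily. *)
Definition cylinders (J : {set I}) : set (set T) :=
  [set B | exists2 A : I -> set R, (forall i, measurable (A i)) &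
     B = \bigcap_(i in [set` J]) (X i @^-1` A i)].

(** The sample space itself, with the sigma-algebra of the subfamily: the
    identity is then a random element carrying all the coordinates in [J]. *)
Definition subfamily_type (J : {set I}) := g_sigma_algebraType (cylinders J).

Lemma cylinders_measurable J : cylinders J `<=` measurable.
Proof.
move=> _ [A mA ->]; apply: fin_bigcap_measurable => // i _.
by rewrite -[_ @^-1` _]setTI; exact: measurable_funP.
Qed.

Lemma cylinders_setI J : setI_closed (cylinders J).
Proof.
move=> _ _ [A mA ->] [B mB ->]; exists (fun i => A i `&` B i).
  by move=> i; exact: measurableI.
by rewrite -bigcapI.
Qed.

Lemma cylinders_setT J : cylinders J setT.
Proof. by exists (fun=> setT) => //; rewrite bigcapT. Qed.

Lemma subfamily_measurable J (A : set T) :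
  <<s cylinders J >> A -> measurable A.
Proof.
move: A; apply: smallest_sub; first exact: sigma_algebra_measurable.
exact: cylinders_measurable.
Qed.

Lemma subfamily_id_measurable J :
  measurable_fun [set: T] (id : T -> subfamily_type J).
Proof. by move=> _ A mA; rewrite setTI preimage_id; exact: (subfamily_measurable mA). Qed.

Lemma subfamily_coord_measurable (J : {set I}) i : i \in J ->
  measurable_fun [set: subfamily_type J] (X i : subfamily_type J -> R).
Proof.
move=> iJ _ A mA; rewrite setTI; apply: sub_sigma_algebra.
exists (fun j => if j == i then A else setT).
  by move=> j; case: ifP.
apply/seteqP; split=> [w Aw j/= _|w /(_ i iJ)/=]; last by rewrite eqxx.
by case: eqP => [->|].
Qed.

Hypothesis indX : mutually_independent X.

(** A finite intersection of events of [J] and one of a new coordinate is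
    again a cylinder, so the product rule extends from the pi-system to the
    sigma-algebra that it generates. *)
Lemma subfamily_indep (J : {set I}) k (A : set T) (B : set R) :
  k \notin J -> <<s cylinders J >> A -> measurable B ->
  P (A `&` X k @^-1` B) = (P A * P (X k @^-1` B))%E.
Proof.
move=> kJ sA mB.
have mXB : measurable (X k @^-1` B).
  by rewrite -[_ @^-1` _]setTI; exact: measurable_funP.
have fXB : (0 <= fine (P (X k @^-1` B)))%R by rewrite fine_ge0.
pose m2 := mscale (NngNum fXB) P.
rewrite -[LHS]/(mrestr P mXB A).
rewrite -[P (X k @^-1` B)]fineK ?fin_num_measure// muleC.
rewrite -[RHS]/(m2 A).
apply: (g_sigma_algebra_measure_unique (cylinders J)
  (@cylinders_measurable J) (fun=> setT) _ _ (mrestr P mXB) m2) => //.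
- by move=> _; exact: cylinders_setT.
- by rewrite bigcup_const//; exists 0%N.
- exact: cylinders_setI.
- move=> _ [C mC ->]; rewrite /m2 /mrestr/= /mscale/=.
  rewrite fineK ?fin_num_measure// muleC.
  pose D i := if i == k then B else C i.
  have mD i : measurable (D i) by rewrite /D; case: ifP.
  rewrite -[LHS]/(P (\bigcap_(i in [set` J]) X i @^-1` C i `&` X k @^-1` B)).
  have -> : \bigcap_(i in [set` J]) X i @^-1` C i `&` X k @^-1` B
          = \bigcap_(i in [set` k |: J]) X i @^-1` D i.
    apply/seteqP; split=> [w [CJ Bk] i/=|w CDw].
      rewrite in_setU1 => /predU1P[->|iJ]; rewrite /D ?eqxx//.
      by case: eqP => [->//|_]; exact: CJ.
    split=> [i/= iJ|]; last first.
      by have := CDw k; rewrite /D eqxx; apply; rewrite /= setU11.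
    have := CDw i; rewrite /D; case: eqP => [ik|_]; last first.
      by apply; rewrite /= in_setU1 iJ orbT.
    by move: kJ; rewrite -ik iJ.
  rewrite (indX (k |: J) mD) (indX J mC) big_setU1//= muleC; congr (_ * _)%E.
    apply: eq_bigr => i iJ; rewrite /D; case: eqP => // ik.
    by move: kJ; rewrite -ik iJ.
  by rewrite /D eqxx.
- move=> _; rewrite (@le_lt_trans _ _ 1%E) ?ltry//.
  by rewrite /mrestr/= probability_le1// setTI.
Qed.

Lemma Ex_indep_coord (J : {set I}) k (f : subfamily_type J * R -> R) :
  k \notin J -> bmeas f -> (forall x, 0 <= f x) ->
  \int[P]_w f (w, X k w) = \int[P]_w \int[P]_v f (w, X k v).
Proof.
move=> kJ bf f0.
pose xi : {mfun T >-> subfamily_type J} :=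
  HB.pack (id : T -> subfamily_type J)
    (isMeasurableFun.Build _ _ _ _ _ (@subfamily_id_measurable J)).
apply: (@Ex_decouple _ _ _ _ _ _ _ P xi (X k)) => // A B mA mB.
exact: (subfamily_indep kJ mA mB).
Qed.

Lemma Ex_prod_indep (f : I -> R -> R) (J : {set I}) :
  (forall i, bmeas (f i)) -> (forall i x, 0 <= f i x) ->
  \int[P]_w (\prod_(i in J) f i (X i w)) = \prod_(i in J) \int[P]_w f i (X i w).
Proof.
move=> bf f0; elim/finset_ind: J => [|k J kJ IHJ].
  by under eq_Rintegral do rewrite big_set0; rewrite Ex_cst big_set0.
under eq_Rintegral do rewrite big_setU1//=; rewrite big_setU1//= -IHJ.
have bJ : bmeas (fun w : subfamily_type J => \prod_(i in J) f i (X i w)).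
  apply: bmeas_prod => i iJ; apply: (bmeas_comp (bf i)).
  exact: subfamily_coord_measurable.
pose g (z : subfamily_type J * R) := f k z.2 * \prod_(i in J) f i (X i z.1).
have bg : bmeas g.
  apply: bmeasM; first exact: (bmeas_comp (bf k)).
  exact: (bmeas_comp bJ).
have g0 z : 0 <= g z by rewrite mulr_ge0 ?prodr_ge0.
rewrite (Ex_indep_coord kJ bg g0) -ExZ; last first.
  by apply: bmeas_prod => i _; exact: (bmeas_comp_mfun _ (bf i)).
apply: eq_Rintegral => w _; rewrite /g/= mulrC -ExZ; last exact: bmeas_comp_mfun.
by apply: eq_Rintegral => v _; rewrite mulrC.
Qed.

End sub_sigma_algebra.

Section two_samples.
Context {R : realType} {d : measure_display} {T : measurableType d}.
Variable P : probability T R.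

(** The sample space with the sigma-algebra of a whole sample, so that the
    independence of two samples is that of two copies of the identity. *)
Definition sample_type (I : finType) (X : I -> {RV P >-> R}) :=
  g_sigma_algebraType
    [set B : set T | exists i A, measurable A /\ B = X i @^-1` A].

Lemma sample_measurable (I : finType) (X : I -> {RV P >-> R}) (A : set T) :
  sigma_generated X A -> measurable A.
Proof.
move: A; apply: smallest_sub; first exact: sigma_algebra_measurable.
move=> _ [i [A [mA ->]]].
by rewrite -[_ @^-1` _]setTI; exact: measurable_funP.
Qed.

Lemma sample_id_measurable (I : finType) (X : I -> {RV P >-> R}) :
  measurable_fun [set: T] (id : T -> sample_type X).
Proof. by move=> _ A mA; rewrite setTI preimage_id; exact: (sample_measurable mA). Qed.

Lemma sample_coord_measurable (I : finType) (X : I -> {RV P >-> R}) i :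
  measurable_fun [set: sample_type X] (X i : sample_type X -> R).
Proof.
move=> _ A mA; rewrite setTI; apply: sub_sigma_algebra.
by exists i, A.
Qed.

Lemma Ex_two_samples (I J : finType) (X : I -> {RV P >-> R})
    (Y : J -> {RV P >-> R}) (f : sample_type X * sample_type Y -> R) :
  independent_samples X Y -> bmeas f -> (forall x, 0 <= f x) ->
  \int[P]_w f (w, w) = \int[P]_w \int[P]_v f (w, v).
Proof.
move=> indXY bf f0.
pose xi : {mfun T >-> sample_type X} :=
  HB.pack (id : T -> sample_type X)
    (isMeasurableFun.Build _ _ _ _ _ (@sample_id_measurable I X)).
pose eta : {mfun T >-> sample_type Y} :=
  HB.pack (id : T -> sample_type Y)
    (isMeasurableFun.Build _ _ _ _ _ (@sample_id_measurable J Y)).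
apply: (@Ex_decouple _ _ _ _ _ _ _ P xi eta) => //.
Qed.

End two_samples.

(** * Exponential moments of centred sums and of degenerate kernels *)

Lemma expR_le_inv {R : realType} (x : R) : x < 1 -> expR x <= (1 - x)^-1.
Proof.
move=> x1; rewrite -[x in expR x]opprK expRN lef_pV2 ?posrE ?expR_gt0 ?subr_gt0//.
exact: expR_ge1Dx.
Qed.

Lemma expR_le_quad {R : realType} (x : R) : x <= 2^-1 ->
  expR x <= 1 + x + 2 * x ^+ 2.
Proof.
move=> x2; have x1 : x < 1 by lra.
rewrite (le_trans (expR_le_inv x1))// -[leLHS]mul1r ler_pdivrMr ?subr_gt0//.
rewrite -subr_ge0.
rewrite (_ : _ - _ = x ^+ 2 * (1 - 2 * x)); last by ring.
by rewrite mulr_ge0 ?sqr_ge0//; lra.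
Qed.

(** The linear term disappears for a centred variable, which turns a first
    exponential moment into the exponential moment of a square. *)
Lemma expR_le_centered {R : realType} (x : R) : expR x <= x + expR (2 * x ^+ 2).
Proof.
have [x2|x2] := leP x 2^-1.
  rewrite (le_trans (expR_le_quad x2))// addrAC addrC lerD2l.
  exact: expR_ge1Dx.
apply: (@le_trans _ _ (expR (2 * x ^+ 2))); last by rewrite lerDr; lra.
by rewrite ler_expR expr2; nra.
Qed.

Lemma expR_mean_le {R : realType} n (a : 'I_n -> R) : (0 < n)%N ->
  expR (n%:R^-1 * \sum_(j < n) a j) <= n%:R^-1 * \sum_(j < n) expR (a j).
Proof.
move=> n0; have n0' : n%:R != 0 :> R by rewrite pnatr_eq0 -lt0n.
set A := _^-1 * _; apply: (@le_trans _ _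
    (n%:R^-1 * \sum_(j < n) expR A * (1 + (a j - A)))).
  have -> : \sum_(j < n) expR A * (1 + (a j - A)) = expR A * n%:R.
    rewrite -mulr_sumr !big_split/= !sumr_const card_ord; congr (_ * _).
    rewrite -[\sum_(i < n) a i](mulVKf n0') -/A mulNrn -[A *+ n]mulr_natl.
    by rewrite subrr addr0.
  by rewrite mulrCA mulVf ?mulr1.
rewrite ler_wpM2l ?invr_ge0//; apply: ler_sum => j _.
rewrite -[in leRHS](subrKC A (a j)) expRD ler_wpM2l ?expR_ge0//.
exact: expR_ge1Dx.
Qed.

Section exponential_moments.
Context {R : realType} {d : measure_display} {T : measurableType d}.
Variable P : probability T R.

Lemma Ex_expR_centered (f : T -> R) : bmeas f -> \int[P]_w f w = 0 ->
  \int[P]_w expR (f w) <= \int[P]_w expR (2 * f w ^+ 2).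
Proof.
move=> bf f0; have bf2 : bmeas (fun w => expR (2 * f w ^+ 2)).
  by apply/bmeas_expR/bmeasZ/bmeasX.
rewrite -[leRHS]add0r -[X in _ <= X + _]f0 -ExD//.
apply: Ex_le => [|| w]; [exact: bmeas_expR|exact: bmeasD|].
exact: expR_le_centered.
Qed.

Context {I : finType} (X : I -> {RV P >-> R}).
Hypothesis indX : mutually_independent X.

(** The exponential moment of the square of a sum is peeled one summand at a
    time: integrating out one centred summand bounded by [c] turns
    [S ^+ 2 / M] into [S ^+ 2 / (M - 8 c ^+ 2)] plus a constant. *)
Lemma Ex_expR_sqr_sum (f : I -> R -> R) (c : R) (J : {set I}) (M : R) :
  (forall i, measurable_fun [set: R] (f i)) -> (forall i x, `|f i x| <= c) ->
  (forall i, \int[P]_w f i (X i w) = 0) ->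
  8 * c ^+ 2 * #|J|%:R < M ->
  \int[P]_w expR ((\sum_(i in J) f i (X i w)) ^+ 2 / M) <=
    expR (#|J|%:R * c ^+ 2 / (M - 8 * c ^+ 2 * #|J|%:R)).
Proof.
move=> mf fc Ef0.
have bf i : bmeas (f i) by split => //; exists c.
elim/finset_ind: J M => [|k J kJ IHJ] M.
  rewrite cards0 mulr0 => M0.
  under eq_Rintegral do rewrite big_set0 expr0n mul0r expR0.
  by rewrite Ex_cst !mul0r expR0.
rewrite cardsU1 kJ natrD [(nat_of_bool _)%:R]/(1%:R) mulrDr mulr1.
set K := 8 * c ^+ 2; set p := #|J|%:R => KM.
have K0 : 0 <= K by rewrite mulr_ge0// sqr_ge0.
have p0 : 0 <= p by [].
have Kp0 : 0 <= K * p by rewrite mulr_ge0.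
have M0 : 0 < M by lra.
have MK0 : 0 < M - K by lra.
have MKp0 : 0 < M - K - K * p by lra.
under eq_Rintegral do rewrite big_setU1//=.
have bSJ : bmeas (fun w : subfamily_type X J => \sum_(i in J) f i (X i w)).
  apply: bmeas_sum => i iJ; apply: (bmeas_comp (bf i)).
  exact: subfamily_coord_measurable.
pose g (z : subfamily_type X J * R) :=
  expR ((f k z.2 + \sum_(i in J) f i (X i z.1)) ^+ 2 / M).
have bg : bmeas g.
  apply/bmeas_expR/bmeasM/bmeas_cst/bmeasX/bmeasD.
    exact: (bmeas_comp (bf k)).
  exact: (bmeas_comp bSJ).
have g0 z : 0 <= g z by exact: expR_ge0.
rewrite (Ex_indep_coord indX kJ bg g0).
have bS : bmeas (fun w => \sum_(i in J) f i (X i w)).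
  by apply: bmeas_sum => i _; exact: bmeas_comp_mfun.
apply: (@le_trans _ _ (\int[P]_w (expR (c ^+ 2 / M) *
    expR ((\sum_(i in J) f i (X i w)) ^+ 2 / (M - K))))).
  apply: Ex_le.
  - pose g' (z : T * T) :=
      expR ((f k (X k z.2) + \sum_(i in J) f i (X i z.1)) ^+ 2 / M).
    apply: (@bmeas_Exl _ _ _ _ _ P g') => [|z]; last exact: expR_ge0.
    apply/bmeas_expR/bmeasM/bmeas_cst/bmeasX/bmeasD.
      exact: (bmeas_comp (bmeas_comp_mfun (X k) (bf k))).
    exact: (bmeas_comp bS).
  - by apply/bmeasZ/bmeas_expR/bmeasM/bmeas_cst/bmeasX.
  move=> w; set S := \sum_(i in J) f i (X i w); rewrite /g/= -/S.
  have bfk : bmeas (fun v => f k (X k v)) by exact: bmeas_comp_mfun.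
  apply: (@le_trans _ _ (\int[P]_v (expR (S ^+ 2 / M + c ^+ 2 / M) *
      expR (2 * S / M * f k (X k v))))).
    apply: Ex_le.
    - by apply/bmeas_expR/bmeasM/bmeas_cst/bmeasX/bmeasD => //; exact: bmeas_cst.
    - by apply/bmeasZ/bmeas_expR/bmeasZ.
    move=> v; rewrite -expRD ler_expR.
    have fk2 : f k (X k v) ^+ 2 <= c ^+ 2.
      by rewrite -real_normK ?num_real// lerXn2r// ?nnegrE// (le_trans _ (fc k 0)).
    have -> : (f k (X k v) + S) ^+ 2 / M = S ^+ 2 / M + f k (X k v) ^+ 2 / M +
      2 * S / M * f k (X k v) by ring.
    by rewrite lerD2r lerD2l ler_pM2r ?invr_gt0.
  rewrite ExZ; last by apply/bmeas_expR/bmeasZ.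
  have h : \int[P]_v expR (2 * S / M * f k (X k v)) <= expR (K * S ^+ 2 / M ^+ 2).
    apply: le_trans (Ex_expR_centered _ _) _; first exact: bmeasZ.
      by rewrite ExZ// Ef0 mulr0.
    apply: Ex_le_cst => [|v]; first by apply/bmeas_expR/bmeasZ/bmeasX/bmeasZ.
    have fk2 : f k (X k v) ^+ 2 <= c ^+ 2.
      by rewrite -real_normK ?num_real// lerXn2r// ?nnegrE// (le_trans _ (fc k 0)).
    rewrite ler_expR exprMn mulrA.
    have -> : K * S ^+ 2 / M ^+ 2 = 2 * (2 * S / M) ^+ 2 * c ^+ 2.
      by rewrite /K; field; rewrite gt_eqF.
    by rewrite ler_wpM2l// mulr_ge0 ?sqr_ge0.
  apply: le_trans (ler_wpM2l (expR_ge0 _) h) _.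
  rewrite -!expRD ler_expR addrAC [leRHS]addrC lerD2r.
  rewrite -subr_ge0.
  have -> : S ^+ 2 / (M - K) - (S ^+ 2 / M + K * S ^+ 2 / M ^+ 2) =
     S ^+ 2 * K ^+ 2 / (M ^+ 2 * (M - K)).
    by field; rewrite !gt_eqF.
  by rewrite divr_ge0// mulr_ge0 ?sqr_ge0// ltW.
rewrite ExZ; last by apply/bmeas_expR/bmeasM/bmeas_cst/bmeasX.
have := IHJ (M - K); rewrite -/K -/p => /(_ ltac:(lra)) IH.
apply: le_trans (ler_wpM2l (expR_ge0 _) IH) _.
rewrite -expRD ler_expR.
have -> : M - (K + K * p) = M - K - K * p by ring.
have -> : (1 + p) * c ^+ 2 = c ^+ 2 + p * c ^+ 2 by ring.
rewrite [leRHS]mulrDl lerD2r ler_wpM2l ?sqr_ge0// lef_pV2 ?posrE//; lra.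
Qed.

End exponential_moments.

Lemma bmeas_pair_sum {R : realType} {d1 d2 : measure_display}
    {U1 : measurableType d1} {U2 : measurableType d2} (I : finType)
    (g : R * R -> R) (x : I -> U1 -> R) (y : U2 -> R) :
  bmeas g -> (forall i, measurable_fun [set: U1] (x i)) ->
  measurable_fun [set: U2] y ->
  bmeas (fun z : U1 * U2 => \sum_(i in I) g (x i z.1, y z.2)).
Proof.
move=> bg mx my; apply: bmeas_sum => i _.
apply: (bmeas_comp bg); apply: measurable_fun_pair.
  exact: (measurableT_comp (mx i)).
exact: (measurableT_comp my).
Qed.

Section degenerate.
Context {R : realType} {d : measure_display} {T : measurableType d}.
Variable P : probability T R.
Variables (m n : nat) (X : 'I_m -> {RV P >-> R}) (Y : 'I_n -> {RV P >-> R}).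
Hypothesis indX : mutually_independent X.
Hypothesis indY : mutually_independent Y.
Hypothesis indXY : independent_samples X Y.
Variables (g : R * R -> R) (c : R).
Hypothesis mg : measurable_fun [set: R * R] g.
Hypothesis gc : forall z, `|g z| <= c.
Hypothesis gX : forall i y, \int[P]_w g (X i w, y) = 0.
Hypothesis gY : forall j x, \int[P]_w g (x, Y j w) = 0.

Let bg : bmeas g. Proof. by split => //; exists c. Qed.

Let V (w : T) (y : R) := \sum_(i < m) g (X i w, y).

Let bmeas_V w : bmeas (V w).
Proof.
apply: bmeas_sum => i _; apply: (bmeas_comp bg).
exact: measurable_fun_pair.
Qed.

(** Given the first sample the kernel sums are independent and centred, so
    their exponential moment is at most that of [2 * tau ^+ 2 * V ^+ 2]; the
    latter is averaged over the second sample by convexity, and bounded, for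
    each value of the second variable, as the square of a centred sum in the
    first sample. *)
Lemma Ex_expR_degenerate (s : R) : (0 < m)%N -> (0 < n)%N -> 0 < c ->
  32 * c ^+ 2 * s ^+ 2 <= m%:R * n%:R ->
  \int[P]_w expR (s * ((m%:R * n%:R)^-1 *
     \sum_(i < m) \sum_(j < n) g (X i w, Y j w))) <= expR 8^-1.
Proof.
move=> m0 n0 c0 sle; set tau := s / (m%:R * n%:R).
have m0' : 0 < m%:R :> R by rewrite ltr0n.
have n0' : 0 < n%:R :> R by rewrite ltr0n.
pose f (z : sample_type X * sample_type Y) : R :=
  expR (tau * \sum_(j < n) \sum_(i < m) g (X i z.1, Y j z.2)).
have bf : bmeas f.
  apply/bmeas_expR/bmeasZ/bmeas_sum => j _.
  apply: (bmeas_pair_sum (x := fun i => X i : sample_type X -> R)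
    (y := Y j : sample_type Y -> R)) => //.
    by move=> i; exact: sample_coord_measurable.
  exact: sample_coord_measurable.
have f0 z : 0 <= f z by exact: expR_ge0.
have -> : \int[P]_w expR (s * ((m%:R * n%:R)^-1 *
     \sum_(i < m) \sum_(j < n) g (X i w, Y j w))) = \int[P]_w f (w, w).
  by apply: eq_Rintegral => w _; rewrite /f/= exchange_big/= mulrA.
rewrite (Ex_two_samples indXY bf f0).
pose h j (z : T * T) : R := expR (2 * n%:R * tau ^+ 2 * V z.1 (Y j z.2) ^+ 2).
have bh j : bmeas (h j).
  apply/bmeas_expR/bmeasZ/bmeasX.
  by apply: (bmeas_pair_sum (x := fun i => X i) (y := Y j)).
pose H z := n%:R^-1 * \sum_(j < n) h j z.
have bH : bmeas H by apply/bmeasZ/bmeas_sum => j _; exact: bh.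
have H0 z : 0 <= H z.
  by rewrite mulr_ge0 ?invr_ge0// sumr_ge0// => j _; exact: expR_ge0.
apply: (@le_trans _ _ (\int[P]_w \int[P]_v H (w, v))).
  apply: Ex_le.
  - pose f' (z : T * T) : R :=
      expR (tau * \sum_(j < n) \sum_(i < m) g (X i z.1, Y j z.2)).
    apply: (@bmeas_Exl _ _ _ _ _ P f') => [|z]; last exact: expR_ge0.
    apply/bmeas_expR/bmeasZ/bmeas_sum => j _.
    by apply: (bmeas_pair_sum (x := fun i => X i) (y := Y j)).
  - exact: bmeas_Exl.
  move=> w.
  have -> : \int[P]_v f (w, v) =
      \int[P]_v \prod_(j in [set: 'I_n]%SET) expR (tau * V w (Y j v)).
    apply: eq_Rintegral => v _; rewrite /f/= mulr_sumr expR_sum.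
    by apply: eq_bigl => j; rewrite finset.in_setT.
  rewrite (Ex_prod_indep indY (f := fun j y => expR (tau * V w y)))//; last first.
    by move=> _; apply/bmeas_expR/bmeasZ.
  apply: (@le_trans _ _ (\prod_(j in [set: 'I_n]%SET)
      \int[P]_v expR (2 * (tau * V w (Y j v)) ^+ 2))).
    apply: ler_prod => j _; apply/andP; split.
      by apply: Rintegral_ge0 => *; exact: expR_ge0.
    apply: Ex_expR_centered; first by apply/bmeasZ/bmeas_comp_mfun.
    rewrite ExZ; last exact: bmeas_comp_mfun.
    rewrite Ex_sum => [|i].
      by rewrite big1 ?mulr0// => i _; exact: gY.
    by apply: (bmeas_comp bg); exact: measurable_fun_pair.
  rewrite -(Ex_prod_indep indY (f := fun j y => expR (2 * (tau * V w y) ^+ 2)))//; last first.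
    by move=> _; apply/bmeas_expR/bmeasZ/bmeasX/bmeasZ.
  apply: Ex_le.
  - apply: bmeas_prod => j _; apply/bmeas_expR/bmeasZ/bmeasX/bmeasZ.
    exact: bmeas_comp_mfun.
  - exact: bmeas_sectionl.
  move=> v; rewrite (eq_bigl predT) => [|j]; last by rewrite finset.in_setT.
  rewrite -expR_sum /H/=.
  have -> : \sum_(j < n) 2 * (tau * V w (Y j v)) ^+ 2 =
     n%:R^-1 * \sum_(j < n) (2 * n%:R * tau ^+ 2 * V w (Y j v) ^+ 2).
    rewrite mulr_sumr; apply: eq_bigr => j _.
    by rewrite exprMn; field; rewrite gt_eqF.
  exact: expR_mean_le.
rewrite (Ex_swap P P bH H0); apply: Ex_le_cst.
  have bH' : bmeas (fun z : T * T => H (z.2, z.1)).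
    by apply: (bmeas_comp bH); exact: measurable_fun_pair.
  exact: (@bmeas_Exl _ _ _ _ _ P _ bH').
move=> v; rewrite /H ExZ; last by apply: bmeas_sum => j _; exact: bmeas_sectionr.
rewrite Ex_sum => [|j]; last exact: bmeas_sectionr.
apply: (@le_trans _ _ (n%:R^-1 * \sum_(j < n) expR 8^-1)); last first.
  by rewrite sumr_const card_ord -[expR _ *+ n]mulr_natl mulKf// gt_eqF.
rewrite ler_wpM2l ?invr_ge0//; apply: ler_sum => j _.
(* Twice the threshold [8 * c ^+ 2 * m] required of the scale of the square. *)
set M : R := 16 * c ^+ 2 * m%:R.
have c20 : 0 < c ^+ 2 by rewrite exprn_gt0.
have M0 : 0 < M by rewrite /M !mulr_gt0.
apply: (@le_trans _ _ (\int[P]_w expR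
   ((\sum_(i in [set: 'I_m]%SET) g (X i w, Y j v)) ^+ 2 / M))).
  apply: Ex_le.
  - exact: bmeas_sectionr.
  - apply/bmeas_expR/bmeasM/bmeas_cst/bmeasX/bmeas_sum => i _.
    by apply: (bmeas_comp bg); exact: measurable_fun_pair.
  move=> w; rewrite /h/= ler_expR -/(V w (Y j v)).
  rewrite (eq_bigl predT) => [|i]; last by rewrite finset.in_setT.
  rewrite -/(V w (Y j v)) mulrC ler_wpM2l ?sqr_ge0// -[leRHS]div1r.
  rewrite ler_pdivlMr// /M /tau.
  have -> : 2 * n%:R * (s / (m%:R * n%:R)) ^+ 2 * (16 * c ^+ 2 * m%:R) =
    (32 * c ^+ 2 * s ^+ 2) / (m%:R * n%:R) by field; rewrite !gt_eqF.
  by rewrite ler_pdivrMr ?mul1r// mulr_gt0.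
apply: (le_trans (Ex_expR_sqr_sum (f := fun=> fun x => g (x, Y j v)) (c := c) indX _ _ _ _)) => //.
- by move=> i; apply: (measurableT_comp mg); exact: measurable_fun_pair.
- by rewrite finset.cardsT card_ord /M ltr_pM2r// ltr_pM2r// ltr_nat.
rewrite finset.cardsT card_ord /M.
have -> : 16 * c ^+ 2 * m%:R - 8 * c ^+ 2 * m%:R = 8 * (m%:R * c ^+ 2) by ring.
by rewrite ler_expR invfM mulrCA mulfV ?mulr1// gt_eqF// mulr_gt0.
Qed.

End degenerate.

(** * Logarithmic moment generating functions *)

(** The mean value theorem for the remainder, whose derivative
    [expR y - 1 - y] lies between 0 and [2 * y ^+ 2]. *)
Lemma expR_taylor2 {R : realType} (x : R) : `|x| <= 2^-1 ->
  `|expR x - 1 - x - x ^+ 2 / 2| <= 2 * `|x| ^+ 3.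
Proof.
move=> x2.
pose f (y : R) := expR y - 1 - y - y ^+ 2 / 2.
pose df (y : R) := expR y - 1 - y.
have fdf y : is_derive y (1 : R) f (df y).
  rewrite /f /df; apply: is_derive_eq.
  by rewrite /GRing.scale/= !mulr1; field.
have cf y : {for y, continuous f}.
  by apply: differentiable_continuous; apply/derivable1_diffP; case: (fdf y).
have dfb y : `|y| <= `|x| -> `|df y| <= 2 * `|x| ^+ 2.
  move=> yx; have y2 : `|y| <= 2^-1 := le_trans yx x2.
  have y2' : y <= 2^-1 by exact: le_trans (ler_norm y) y2.
  rewrite /df ger0_norm; last by have := expR_ge1Dx y; lra.
  apply: (@le_trans _ _ (2 * y ^+ 2)); first by have := expR_le_quad y2'; lra.
  by rewrite ler_wpM2l// -real_normK ?num_real// lerXn2r ?nnegrE.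
have f0 : f 0 = 0 by rewrite /f expR0 expr0n /=; ring.
have -> : expR x - 1 - x - x ^+ 2 / 2 = f x by [].
have [x0|x0|x0] := ltgtP x 0.
- have [y] := MVT_segment (ltW x0) (fun y _ => fdf y)
    (continuous_subspaceT (fun y => cf y)).
  rewrite in_itv/= => /andP[xy y0]; rewrite f0 sub0r sub0r => /eqP.
  rewrite eqr_oppLR => /eqP ->; rewrite normrN normrM normrN.
  rewrite exprSr mulrA ler_wpM2r//; apply: dfb.
  by rewrite !ler0_norm// ?lerN2// ltW.
- have [y] := MVT_segment (ltW x0) (fun y _ => fdf y)
    (continuous_subspaceT (fun y => cf y)).
  rewrite in_itv/= => /andP[y0 yx]; rewrite f0 !subr0 => ->.
  rewrite normrM exprSr mulrA ler_wpM2r//; apply: dfb.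
  by rewrite !ger0_norm// ltW.
- by rewrite x0 f0 normr0 mulr_ge0.
Qed.

(** With [z = y / (1 + y)] one has [(1 - z)^-1 = 1 + y], so the upper bound
    [expR z <= (1 - z)^-1] is a lower bound for the logarithm. *)
Lemma ln_ge_quad {R : realType} (y : R) : - 2^-1 <= y -> y - 2 * y ^+ 2 <= ln (1 + y).
Proof.
move=> y2; have y0 : 0 < 1 + y by lra.
have zE : 1 - y / (1 + y) = (1 + y)^-1 by field; rewrite gt_eqF.
have z1 : y / (1 + y) < 1 by rewrite -subr_gt0 zE invr_gt0.
apply: (@le_trans _ _ (y / (1 + y))).
  rewrite ler_pdivlMr// -subr_ge0.
  have -> : y - (y - 2 * y ^+ 2) * (1 + y) = y ^+ 2 * (1 + 2 * y) by ring.
  by rewrite mulr_ge0 ?sqr_ge0//; lra.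
rewrite -ler_expR lnK ?posrE//; have := expR_le_inv z1.
by rewrite zE invrK.
Qed.

Lemma expR_convex {R : realType} (p a b : R) : 0 <= p -> p <= 1 ->
  expR (p * a + (1 - p) * b) <= p * expR a + (1 - p) * expR b.
Proof.
move=> p0 p1; have := convex_expR (Itv01 p0 p1) a b.
by rewrite !convRE/=.
Qed.

Section log_mgf.
Context {R : realType} {d : measure_display} {T : measurableType d}.
Variable P : probability T R.

(** The error involves [f] only through its bound [c], as is needed to sum it
    over samples of growing size. *)
Lemma ln_mgf_centered (f : T -> R) (c tau : R) :
  measurable_fun [set: T] f -> (forall w, `|f w| <= c) ->
  \int[P]_w f w = 0 -> `|tau| * c <= 2^-1 ->
  `|ln (\int[P]_w expR (tau * f w)) - tau ^+ 2 * (\int[P]_w (f w ^+ 2)) / 2|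
     <= 5 * (`|tau| * c) ^+ 3.
Proof.
move=> mf fc f0; set x := `|tau| * c => x2.
have bf : bmeas f by split => //; exists c.
have c0 : 0 <= c.
  rewrite leNgt; apply/negP => c0.
  have : \int[P]_w `|f w| <= c.
    apply: Ex_le_cst => //; split; last by exists c => w; rewrite normr_id.
    exact: measurableT_comp.
  rewrite leNgt => /negP; apply; apply: lt_le_trans c0 _.
  by apply: Rintegral_ge0 => w _; exact: normr_ge0.
have x0 : 0 <= x by rewrite mulr_ge0.
set v := \int[P]_w (f w ^+ 2).
have bf2 : bmeas (fun w => f w ^+ 2) by exact: bmeasX.
have be : bmeas (fun w => expR (tau * f w)) by apply/bmeas_expR/bmeasZ.
set u := \int[P]_w expR _.
have v0 : 0 <= v by apply: Rintegral_ge0 => w _; exact: sqr_ge0.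
have tfx w : `|tau * f w| <= x by rewrite normrM ler_wpM2l.
have vc : tau ^+ 2 * v <= x ^+ 2.
  rewrite -ExZ//; apply: Ex_le_cst => [|w]; first exact: bmeasZ.
  rewrite -exprMn -real_normK ?num_real// lerXn2r ?nnegrE//.
have u1 : `|u - 1 - tau ^+ 2 * v / 2| <= 2 * x ^+ 3.
  have -> : u - 1 - tau ^+ 2 * v / 2 = \int[P]_w
      (expR (tau * f w) - 1 - tau * f w - (tau * f w) ^+ 2 / 2).
    have bt : bmeas (fun w => tau * f w) by exact: bmeasZ.
    have bt2 : bmeas (fun w => (tau * f w) ^+ 2 / 2).
      by apply: bmeasM (bmeas_cst _); exact: bmeasX.
    rewrite ExB//; last by apply/bmeasB => //; apply/bmeasB => //; exact: bmeas_cst.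
    rewrite ExB//; last by apply/bmeasB => //; exact: bmeas_cst.
    rewrite ExB//; last exact: bmeas_cst.
    rewrite Ex_cst ExZ// f0 mulr0 subr0; congr (_ - _).
    transitivity (\int[P]_w (tau ^+ 2 / 2 * f w ^+ 2)).
      by rewrite ExZ// mulrAC.
    by apply: eq_Rintegral => w _; rewrite exprMn mulrAC.
  apply: Ex_norm_le => [|w].
    apply/bmeasB; last by apply: bmeasM (bmeas_cst _); exact/bmeasX/bmeasZ.
    apply/bmeasB; last exact: bmeasZ.
    by apply/bmeasB => //; exact: bmeas_cst.
  apply: (le_trans (expR_taylor2 (le_trans (tfx w) x2))).
  by rewrite ler_wpM2l// lerXn2r ?nnegrE.
have x3 : x ^+ 3 <= x ^+ 2 / 2.
  by rewrite exprSr ler_wpM2l// sqr_ge0.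
have x4 : x ^+ 4 <= x ^+ 3 / 2.
  by rewrite exprSr ler_wpM2l// exprn_ge0.
have x22 : x ^+ 2 <= 4^-1.
  have -> : 4^-1 = (2^-1) ^+ 2 :> R by field.
  by rewrite lerXn2r ?nnegrE.
have x30 : 0 <= x ^+ 3 by rewrite exprn_ge0.
have tv0 : 0 <= tau ^+ 2 * v by rewrite mulr_ge0// sqr_ge0.
set y := u - 1; have uE : u = 1 + y by rewrite /y addrC subrK.
have u0 : 0 < u by exact/Ex_expR_gt0/bmeasZ.
move: u1; rewrite -/y ler_norml => /andP[yl yu].
have yabs : `|y| <= 3 / 2 * x ^+ 2.
  by rewrite ler_norml; apply/andP; split; lra.
have y2 : y ^+ 2 <= 9 / 4 * x ^+ 4.
  have -> : 9 / 4 * x ^+ 4 = (3 / 2 * x ^+ 2) ^+ 2 by field.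
  by rewrite -real_normK ?num_real// lerXn2r ?nnegrE// (le_trans _ yabs).
rewrite ler_norml; apply/andP; split.
  have yy : - 2^-1 <= y by lra.
  by have := ln_ge_quad yy; rewrite -uE; lra.
have : ln u <= y by rewrite uE; apply: le_ln1Dx; lra.
lra.
Qed.

(** Logarithmic moment generating functions are convex: after normalizing both
    exponentials to have mean one this is the pointwise convexity of [expR]. *)
Lemma ln_mgf_convex (f g : T -> R) (p : R) : bmeas f -> bmeas g ->
  0 <= p <= 1 ->
  ln (\int[P]_w expR (p * f w + (1 - p) * g w)) <=
    p * ln (\int[P]_w expR (f w)) + (1 - p) * ln (\int[P]_w expR (g w)).
Proof.
move=> bf bg /andP[p0 p1].
have [u uE] : {u | u = \int[P]_w expR (f w)} by eexists.
have [v vE] : {v | v = \int[P]_w expR (g w)} by eexists.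
have u0 : 0 < u by rewrite uE; exact: Ex_expR_gt0.
have v0 : 0 < v by rewrite vE; exact: Ex_expR_gt0.
rewrite -uE -vE.
have bfg : bmeas (fun w => p * f w + (1 - p) * g w).
  by apply: bmeasD; exact: bmeasZ.
rewrite -ler_expR lnK ?posrE ?Ex_expR_gt0//.
set e := expR _; have e0 : 0 < e by exact: expR_gt0.
have -> : e = \int[P]_w (e * (p / u * expR (f w) + (1 - p) / v * expR (g w))).
  have bfe : bmeas (fun w => p / u * expR (f w)) by exact/bmeasZ/bmeas_expR.
  have bge : bmeas (fun w => (1 - p) / v * expR (g w)) by exact/bmeasZ/bmeas_expR.
  rewrite ExZ; last exact: bmeasD.
  rewrite ExD// ExZ; last exact: bmeas_expR.
  rewrite ExZ; last exact: bmeas_expR.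
  by rewrite -uE -vE; field; rewrite !gt_eqF.
apply: Ex_le => [|| w]; first exact: bmeas_expR.
  by apply/bmeasZ/bmeasD; exact/bmeasZ/bmeas_expR.
move: (f w) (g w) => x y.
have -> : p * x + (1 - p) * y = (p * ln u + (1 - p) * ln v) +
   (p * (x - ln u) + (1 - p) * (y - ln v)) by ring.
rewrite expRD -/e ler_wpM2l ?expR_ge0//.
have -> : p / u * expR x = p * expR (x - ln u).
  by rewrite expRB lnK ?posrE// mulrAC mulrA.
have -> : (1 - p) / v * expR y = (1 - p) * expR (y - ln v).
  by rewrite expRB lnK ?posrE// mulrAC mulrA.
exact: expR_convex.
Qed.

Variables (m n : nat) (X : 'I_m -> {RV P >-> R}) (Y : 'I_n -> {RV P >-> R}).
Hypothesis indX : mutually_independent X.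
Hypothesis indY : mutually_independent Y.
Hypothesis indXY : independent_samples X Y.

(** Independence factors the moment generating function over the observations,
    and [ln_mgf_centered] applies to every factor. *)
Lemma ln_mgf_sums (A B : R -> R) (c tau1 tau2 vA vB : R) :
  measurable_fun [set: R] A -> measurable_fun [set: R] B ->
  (forall x, `|A x| <= c) -> (forall x, `|B x| <= c) ->
  (forall i, \int[P]_w A (X i w) = 0) -> (forall j, \int[P]_w B (Y j w) = 0) ->
  (forall i, \int[P]_w (A (X i w) ^+ 2) = vA) ->
  (forall j, \int[P]_w (B (Y j w) ^+ 2) = vB) ->
  `|tau1| * c <= 2^-1 -> `|tau2| * c <= 2^-1 ->
  `|ln (\int[P]_w expR (tau1 * (\sum_(i < m) A (X i w)) +
                        tau2 * (\sum_(j < n) B (Y j w))))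
     - (m%:R * tau1 ^+ 2 * vA + n%:R * tau2 ^+ 2 * vB) / 2| <=
   5 * c ^+ 3 * (m%:R * `|tau1| ^+ 3 + n%:R * `|tau2| ^+ 3).
Proof.
move=> mA mB Ac Bc EA EB EA2 EB2 t1 t2.
have bA : bmeas A by split => //; exists c.
have bB : bmeas B by split => //; exists c.
pose f (z : sample_type X * sample_type Y) : R :=
  expR (tau1 * (\sum_(i < m) A (X i z.1)) + tau2 * (\sum_(j < n) B (Y j z.2))).
have bf : bmeas f.
  apply/bmeas_expR/bmeasD; apply/bmeasZ/bmeas_sum => i _.
    apply: (bmeas_comp bA).
    exact: (measurableT_comp (@sample_coord_measurable _ _ _ P _ X i)).
  apply: (bmeas_comp bB).
  exact: (measurableT_comp (@sample_coord_measurable _ _ _ P _ Y i)).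
rewrite -[\int[P]_w _]/(\int[P]_w f (w, w)) (Ex_two_samples indXY bf); last first.
  by move=> z; exact: expR_ge0.
pose eA w := \prod_(i in [set: 'I_m]%SET) expR (tau1 * A (X i w)).
pose eB w := \prod_(j in [set: 'I_n]%SET) expR (tau2 * B (Y j w)).
have beB : bmeas eB.
  by apply: bmeas_prod => i _; apply/bmeas_expR/bmeasZ/bmeas_comp_mfun.
have beA : bmeas eA.
  by apply: bmeas_prod => i _; apply/bmeas_expR/bmeasZ/bmeas_comp_mfun.
have -> : \int[P]_w \int[P]_v f (w, v) = (\int[P]_w eA w) * (\int[P]_v eB v).
  rewrite mulrC -ExZ//; apply: eq_Rintegral => w _.
  rewrite mulrC -ExZ//; apply: eq_Rintegral => v _.
  rewrite /f/= expRD !mulr_sumr !expR_sum /eA /eB; congr (_ * _).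
    by apply: eq_bigl => i; rewrite finset.in_setT.
  by apply: eq_bigl => i; rewrite finset.in_setT.
rewrite (Ex_prod_indep indX (f := fun i x => expR (tau1 * A x)))//; last first.
  by move=> _; exact/bmeas_expR/bmeasZ.
rewrite (Ex_prod_indep indY (f := fun i x => expR (tau2 * B x)))//; last first.
  by move=> _; exact/bmeas_expR/bmeasZ.
have bAX i : bmeas (fun w => A (X i w)) by exact: bmeas_comp_mfun.
have bBY j : bmeas (fun w => B (Y j w)) by exact: bmeas_comp_mfun.
have uA i : 0 < \int[P]_w expR (tau1 * A (X i w)) by exact/Ex_expR_gt0/bmeasZ.
have uB j : 0 < \int[P]_w expR (tau2 * B (Y j w)) by exact/Ex_expR_gt0/bmeasZ.
have sum_cst k (x : R) : \sum_(i < k) x = k%:R * x.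
  by rewrite sumr_const card_ord mulr_natl.
have ln_prod (I : finType) (u : I -> R) : (forall i, 0 < u i) ->
    ln (\prod_(i in [set: I]%SET) u i) = \sum_i ln (u i).
  move=> u0; rewrite (eq_bigl predT) => [|i]; last by rewrite finset.in_setT.
  apply: expR_inj; rewrite expR_sum lnK ?posrE ?prodr_gt0//.
  by apply: eq_bigr => i _; rewrite lnK ?posrE.
rewrite lnM ?posrE ?prodr_gt0// !ln_prod//.
have -> : (m%:R * tau1 ^+ 2 * vA + n%:R * tau2 ^+ 2 * vB) / 2 =
    \sum_(i < m) (tau1 ^+ 2 * \int[P]_w (A (X i w) ^+ 2) / 2) +
    \sum_(j < n) (tau2 ^+ 2 * \int[P]_w (B (Y j w) ^+ 2) / 2).
  under eq_bigr do rewrite EA2; under [X in _ = _ + X]eq_bigr do rewrite EB2.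
  by rewrite !sum_cst; field.
have -> : 5 * c ^+ 3 * (m%:R * `|tau1| ^+ 3 + n%:R * `|tau2| ^+ 3) =
    \sum_(i < m) (5 * (`|tau1| * c) ^+ 3) + \sum_(j < n) (5 * (`|tau2| * c) ^+ 3).
  by rewrite !sum_cst; ring.
rewrite opprD addrACA -!sumrB (le_trans (ler_normD _ _))// lerD//.
  rewrite (le_trans (ler_norm_sum _ _ _))//; apply: ler_sum => i _.
  by apply: (ln_mgf_centered (f := fun w => A (X i w))) => //; exact: measurableT_comp.
rewrite (le_trans (ler_norm_sum _ _ _))//; apply: ler_sum => i _.
by apply: (ln_mgf_centered (f := fun w => B (Y i w))) => //; exact: measurableT_comp.
Qed.

End log_mgf.

(** * Two-sample U-statistics *)

Section two_sample_ustat.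
Context {R : realType} {d : measure_display} {T : measurableType d}.
Variable P : probability T R.
Variables (m n : nat) (X : 'I_m -> {RV P >-> R}) (Y : 'I_n -> {RV P >-> R}).
Hypothesis indX : mutually_independent X.
Hypothesis indY : mutually_independent Y.
Hypothesis indXY : independent_samples X Y.
Hypotheses (m0 : (0 < m)%N) (n0 : (0 < n)%N).
Variables (h : R * R -> R) (h1 h2 : R -> R) (theta v1 v2 : R).
Hypotheses (mh : measurable_fun [set: R * R] h)
  (mh1 : measurable_fun [set: R] h1) (mh2 : measurable_fun [set: R] h2).
Hypotheses (hb : forall z, `|h z| <= 1) (h1b : forall x, `|h1 x| <= 1)
  (h2b : forall y, `|h2 y| <= 1) (thetab : `|theta| <= 1).
Hypothesis hX : forall i y, \int[P]_w h (X i w, y) = h2 y.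
Hypothesis hY : forall j x, \int[P]_w h (x, Y j w) = h1 x.
Hypothesis h1X : forall i, \int[P]_w h1 (X i w) = theta.
Hypothesis h2Y : forall j, \int[P]_w h2 (Y j w) = theta.
Hypothesis v1E : forall i, \int[P]_w ((h1 (X i w) - theta) ^+ 2) = v1.
Hypothesis v2E : forall j, \int[P]_w ((h2 (Y j w) - theta) ^+ 2) = v2.

Let A x := h1 x - theta.
Let B y := h2 y - theta.
Let g (z : R * R) := h z - h1 z.1 - h2 z.2 + theta.

Let Lin w := m%:R^-1 * \sum_(i < m) A (X i w) + n%:R^-1 * \sum_(j < n) B (Y j w).
Let U w := (m%:R * n%:R)^-1 * \sum_(i < m) \sum_(j < n) g (X i w, Y j w).
Let W w := (m%:R * n%:R)^-1 * \sum_(i < m) \sum_(j < n) h (X i w, Y j w).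
Let N : R := m%:R * n%:R / (m%:R + n%:R).
Let l : R := m%:R / (m%:R + n%:R).

Let m0' : 0 < m%:R :> R. Proof. by rewrite ltr0n. Qed.
Let n0' : 0 < n%:R :> R. Proof. by rewrite ltr0n. Qed.

Let bh : bmeas h. Proof. by split => //; exists 1. Qed.
Let bh1 : bmeas h1. Proof. by split => //; exists 1. Qed.
Let bh2 : bmeas h2. Proof. by split => //; exists 1. Qed.
Let bA : bmeas A. Proof. exact/bmeasB/bmeas_cst. Qed.
Let bB : bmeas B. Proof. exact/bmeasB/bmeas_cst. Qed.
Let bg : bmeas g.
Proof.
apply: bmeasD (bmeas_cst _); apply: bmeasB; first apply: bmeasB => //.
  exact: (bmeas_comp bh1).
exact: (bmeas_comp bh2).
Qed.

Let sum_cst k (x : R) : \sum_(i < k) x = k%:R * x.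
Proof. by rewrite sumr_const card_ord mulr_natl. Qed.

(** The decomposition into the projections on each sample and a kernel that is
    centred in each variable separately. *)
Lemma hoeffding_decomposition w : W w - theta = Lin w + U w.
Proof.
rewrite /W /U /Lin.
have -> : \sum_(i < m) \sum_(j < n) h (X i w, Y j w) =
    n%:R * (\sum_(i < m) A (X i w)) + m%:R * (\sum_(j < n) B (Y j w)) +
    m%:R * n%:R * theta + \sum_(i < m) \sum_(j < n) g (X i w, Y j w).
  transitivity (\sum_(i < m) (n%:R * A (X i w) + (\sum_(j < n) B (Y j w)) +
      n%:R * theta + \sum_(j < n) g (X i w, Y j w))).
    apply: eq_bigr => i _; rewrite -!sum_cst -!big_split/=.
    by apply: eq_bigr => j _; rewrite /A /B /g/=; ring.
  by rewrite 3!big_split/= -mulr_sumr !sum_cst mulrA.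
move: (\sum_(i < m) A _) (\sum_(j < n) B _) (\sum_(i < m) _) => a b c.
by field; rewrite !gt_eqF.
Qed.

Let bAX i : bmeas (fun w => A (X i w)). Proof. exact: bmeas_comp_mfun. Qed.
Let bBY i : bmeas (fun w => B (Y i w)). Proof. exact: bmeas_comp_mfun. Qed.

Let bLin : bmeas Lin.
Proof.
apply: bmeasD; apply/bmeasZ/bmeas_sum => i _; first exact: bAX.
exact: bBY.
Qed.

Let bU : bmeas U.
Proof.
apply/bmeasZ/bmeas_sum => i _; apply: bmeas_sum => j _; apply: (bmeas_comp bg).
exact: measurable_fun_pair.
Qed.

Let bW : bmeas W.
Proof.
apply/bmeasZ/bmeas_sum => i _; apply: bmeas_sum => j _; apply: (bmeas_comp bh).
exact: measurable_fun_pair.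
Qed.

Let N_gt0 : 0 < N.
Proof. by rewrite /N divr_gt0 ?mulr_gt0 ?addr_gt0. Qed.

Let N_le_m : N <= m%:R.
Proof. by rewrite /N ler_pdivrMr ?addr_gt0// ler_wpM2l ?lerDr// ltW. Qed.

Let N_le_n : N <= n%:R.
Proof. by rewrite /N ler_pdivrMr ?addr_gt0// mulrC ler_wpM2l ?lerDl// ltW. Qed.

Let ln_mgf_Lin r : `|r| <= 4^-1 ->
  `|ln (\int[P]_w expR (r * N * Lin w)) - N * r ^+ 2 * ((1 - l) * v1 + l * v2) / 2|
    <= 80 * N * `|r| ^+ 3.
Proof.
move=> r4.
have Nm : N / m%:R <= 1 by rewrite ler_pdivrMr ?mul1r.
have Nn : N / n%:R <= 1 by rewrite ler_pdivrMr ?mul1r.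
have Nm0 : 0 <= N / m%:R by rewrite divr_ge0 ?ltW.
have Nn0 : 0 <= N / n%:R by rewrite divr_ge0 ?ltW.
have rm : `|r * (N / m%:R)| = `|r| * (N / m%:R).
  by rewrite normrM (ger0_norm Nm0).
have rn : `|r * (N / n%:R)| = `|r| * (N / n%:R).
  by rewrite normrM (ger0_norm Nn0).
have EA i : \int[P]_w A (X i w) = 0.
  by rewrite ExB ?Ex_cst ?h1X ?subrr//; [exact: bmeas_comp_mfun|exact: bmeas_cst].
have EB i : \int[P]_w B (Y i w) = 0.
  by rewrite ExB ?Ex_cst ?h2Y ?subrr//; [exact: bmeas_comp_mfun|exact: bmeas_cst].
have A2 x : `|A x| <= 2.
  by rewrite (le_trans (ler_normB _ _))// -[leRHS]/(1 + 1) lerD.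
have B2 x : `|B x| <= 2.
  by rewrite (le_trans (ler_normB _ _))// -[leRHS]/(1 + 1) lerD.
have r2 x : 0 <= x -> x <= 1 -> `|r| * x * 2 <= 2^-1.
  move=> x0 x1; have : `|r| * x <= 4^-1 * 1 by rewrite ler_pM.
  lra.
have := ln_mgf_sums indX indY indXY (proj1 bA) (proj1 bB) A2 B2 EA EB v1E v2E
  (tau1 := r * (N / m%:R)) (tau2 := r * (N / n%:R)).
rewrite rm rn => /(_ (r2 _ Nm0 Nm) (r2 _ Nn0 Nn)).
have -> : \int[P]_w expR (r * (N / m%:R) * (\sum_(i < m) A (X i w)) +
    r * (N / n%:R) * (\sum_(j < n) B (Y j w))) = \int[P]_w expR (r * N * Lin w).
  apply: eq_Rintegral => w _; congr expR; rewrite /Lin.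
  by move: (\sum_(i < m) A _) (\sum_(j < n) B _) => a b; ring.
have -> : (m%:R * (r * (N / m%:R)) ^+ 2 * v1 + n%:R * (r * (N / n%:R)) ^+ 2 * v2)
   / 2 = N * r ^+ 2 * ((1 - l) * v1 + l * v2) / 2.
  by rewrite /N /l; field; rewrite !gt_eqF ?addr_gt0.
move/le_trans; apply.
have -> : 5 * 2 ^+ 3 * (m%:R * (`|r| * (N / m%:R)) ^+ 3 +
   n%:R * (`|r| * (N / n%:R)) ^+ 3) =
   40 * `|r| ^+ 3 * (N * (N / m%:R) ^+ 2 + N * (N / n%:R) ^+ 2).
  move: (`|r|) => x; field; rewrite !gt_eqF//.
have -> : 80 * N * `|r| ^+ 3 = 40 * `|r| ^+ 3 * (N * 1 ^+ 2 + N * 1 ^+ 2).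
  by rewrite expr1n; ring.
rewrite ler_wpM2l ?mulr_ge0 ?exprn_ge0// lerD// ler_wpM2l ?(ltW N_gt0)//.
  by rewrite lerXn2r ?nnegrE.
by rewrite lerXn2r ?nnegrE.
Qed.

Let ln_mgf_U q : `|q| <= 32^-1 -> ln (\int[P]_w expR (q * N * U w)) <= 8^-1.
Proof.
move=> q32; rewrite -ler_expR lnK ?posrE; last exact/Ex_expR_gt0/bmeasZ.
apply: (Ex_expR_degenerate indX indY indXY (c := 4)) => //.
- by case: bg.
- move=> z; rewrite /g (le_trans (ler_normD _ _))//.
  have -> : 4 = 1 + 1 + 1 + 1 :> R by ring.
  rewrite lerD// (le_trans (ler_normB _ _))// lerD// (le_trans (ler_normB _ _))//.
  by rewrite lerD.
- move=> i y.
  have b1 : bmeas (fun w => h (X i w, y)).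
    by apply: (bmeas_comp bh); exact: measurable_fun_pair.
  have b2 : bmeas (fun w => h1 (X i w)) by exact: bmeas_comp_mfun.
  rewrite /g/= ExD ?Ex_cst; last exact: bmeas_cst.
    rewrite ExB ?Ex_cst//; last exact: bmeas_cst.
      by rewrite ExB// hX h1X; ring.
    exact: bmeasB.
  by apply: bmeasB (bmeas_cst _); exact: bmeasB.
- move=> j x.
  have b1 : bmeas (fun w => h (x, Y j w)).
    by apply: (bmeas_comp bh); exact: measurable_fun_pair.
  have b2 : bmeas (fun w => h2 (Y j w)) by exact: bmeas_comp_mfun.
  have b3 : bmeas (fun w => h (x, Y j w) - h1 x).
    by apply: bmeasB (bmeas_cst _).
  rewrite /g/= ExD ?Ex_cst; last exact: bmeas_cst.
    rewrite ExB//.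
    rewrite ExB ?Ex_cst ?hY ?h2Y//; first by ring.
    exact: bmeas_cst.
  exact: bmeasB.
- have q2 : q ^+ 2 <= 1024^-1.
    have -> : 1024^-1 = (32^-1) ^+ 2 :> R by field.
    by rewrite -real_normK ?num_real// lerXn2r ?nnegrE.
  have N2 : N ^+ 2 <= m%:R * n%:R by rewrite expr2 ler_pM// ltW.
  have qN : (q * N) ^+ 2 <= 1024^-1 * (m%:R * n%:R).
    by rewrite exprMn ler_pM ?sqr_ge0.
  have mn0 : 0 <= m%:R * n%:R :> R by rewrite mulr_ge0.
  have -> : 32 * 4 ^+ 2 * (q * N) ^+ 2 = 512 * (q * N) ^+ 2 by ring.
  by move: ((q * N) ^+ 2) (m%:R * n%:R) qN mn0 => x y; lra.
Qed.

(** The degenerate part enters through log-convexity only: a bounded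
    logarithmic moment generating function is negligible on the exponential
    scale, whatever the weight [q] that it receives. *)
Lemma ln_mgf_ustat (q r : R) : 0 < q <= 2^-1 -> `|r| <= q / 64 ->
  `|ln (\int[P]_w expR (r * N * (W w - theta)))
     - N * r ^+ 2 * ((1 - l) * v1 + l * v2) / 2| <=
  q * (N * r ^+ 2 * ((1 - l) * v1 + l * v2)) + 320 * N * `|r| ^+ 3 + 4^-1.
Proof.
move=> /andP[q0 q2] rq; set w := (1 - l) * v1 + l * v2.
(* The weights of the linear and of the degenerate part are [p] and [q]. *)
set L := ln _; pose p := 1 - q.
have qE : 1 - p = q by rewrite /p; ring.
have p0 : 0 < p by rewrite /p; lra.
have p2 : 2^-1 <= p by rewrite /p; lra.
have p01 : 0 <= p <= 1 by rewrite /p; apply/andP; split; lra.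
have bWt : bmeas (fun w => W w - theta) by apply: bmeasB (bmeas_cst _).
have v10 : 0 <= v1.
  by rewrite -(v1E (Ordinal m0)); apply: Rintegral_ge0 => *; exact: sqr_ge0.
have v20 : 0 <= v2.
  by rewrite -(v2E (Ordinal n0)); apply: Rintegral_ge0 => *; exact: sqr_ge0.
have l0 : 0 <= l by rewrite /l divr_ge0 ?addr_ge0.
have l1 : l <= 1 by rewrite /l ler_pdivrMr ?addr_gt0// mul1r lerDl.
have w0 : 0 <= w by rewrite /w addr_ge0// mulr_ge0// subr_ge0.
have rp : `|r / p| <= 4^-1.
  rewrite normrM [`|p^-1|]gtr0_norm ?invr_gt0// ler_pdivrMr//.
  by apply: le_trans rq _; lra.
have rq' : `|r / q| <= 32^-1.
  rewrite normrM [`|q^-1|]gtr0_norm ?invr_gt0// ler_pdivrMr//.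
  by apply: le_trans rq _; lra.
have prq : `|- (p * r / q)| <= 32^-1.
  rewrite normrN -mulrA normrM (gtr0_norm p0) (le_trans _ rq')//.
  by rewrite ler_piMl//; case/andP: p01.
have pr : `|p * r| <= 4^-1.
  rewrite normrM (gtr0_norm p0); apply: (@le_trans _ _ (`|r|)).
    by rewrite ler_piMl//; case/andP: p01.
  by apply: le_trans rq _; lra.
set r3 := `|r| ^+ 3; have r30 : 0 <= r3 by rewrite exprn_ge0.
have upper : L <= p * (N * (r / p) ^+ 2 * w / 2 + 80 * N * `|r / p| ^+ 3) + q / 8.
  have := ln_mgf_convex P (bmeasZ (r / p * N) bLin) (bmeasZ (r / q * N) bU) p01.
  rewrite qE (_ : \int[P]_x _ = \int[P]_x expR (r * N * (W x - theta))); last first.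
    apply: eq_Rintegral => x _; rewrite hoeffding_decomposition; congr expR => /=.
    by move: (Lin x) (U x) => a b; field; rewrite !gt_eqF.
  move/le_trans; apply; rewrite lerD//.
    rewrite ler_wpM2l ?(ltW p0)//; have := ln_mgf_Lin rp.
    by rewrite -/w ler_norml lerBlDr => /andP[_]; rewrite addrC.
  by rewrite ler_wpM2l ?(ltW q0)//; exact: ln_mgf_U.
have lower : N * (p * r) ^+ 2 * w / 2 - 80 * N * `|p * r| ^+ 3 <= p * L + q / 8.
  have := ln_mgf_convex P (bmeasZ (r * N) bWt) (bmeasZ (- (p * r / q) * N) bU) p01.
  rewrite qE (_ : \int[P]_x _ = \int[P]_x expR (p * r * N * Lin x)); last first.
    apply: eq_Rintegral => x _; rewrite hoeffding_decomposition; congr expR => /=.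
    by move: (Lin x) (U x) => a b; field; rewrite !gt_eqF.
  have LP := ln_mgf_Lin pr.
  move=> h'; apply: le_trans (le_trans h' _).
    move: LP; rewrite -/w ler_norml => /andP[+ _].
    by rewrite lerBrDr addrC.
  by rewrite lerD2l ler_wpM2l ?(ltW q0)//; exact: ln_mgf_U.
set K := N * r ^+ 2 * w.
have K0 : 0 <= K by exact: mulr_ge0 (mulr_ge0 (ltW N_gt0) (sqr_ge0 r)) w0.
have Nr3 : 0 <= N * r3 by exact: mulr_ge0 (ltW N_gt0) r30.
have upE : p * (N * (r / p) ^+ 2 * w / 2 + 80 * N * `|r / p| ^+ 3) =
    K * p^-1 / 2 + 80 * (N * r3) * p^-1 ^+ 2.
  rewrite normrM [`|p^-1|]gtr0_norm ?invr_gt0// /K /r3.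
  by move: `|r| (N) => x y; field; rewrite gt_eqF.
have loE : N * (p * r) ^+ 2 * w / 2 - 80 * N * `|p * r| ^+ 3 =
    p * (p * K / 2 - 80 * (N * r3) * p ^+ 2).
  rewrite normrM (gtr0_norm p0) /K /r3.
  by move: `|r| (N) => x y; field.
have ip : p^-1 <= 1 + 2 * q.
  rewrite -div1r ler_pdivrMr// /p.
  have : 0 <= q * (1 - 2 * q) by rewrite mulr_ge0 ?(ltW q0)//; lra.
  by move=> ?; rewrite -subr_ge0 (_ : _ - _ = q * (1 - 2 * q))//; ring.
have ip2 : p^-1 <= 2 by rewrite (le_trans ip)//; lra.
have ip0 : 0 <= p^-1 by rewrite invr_ge0 ltW.
rewrite upE in upper; rewrite loE in lower.
have Kip : K * p^-1 <= K * (1 + 2 * q) by rewrite ler_wpM2l.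
have Nip : 80 * (N * r3) * p^-1 ^+ 2 <= 80 * (N * r3) * 4.
  rewrite ler_wpM2l ?mulr_ge0//.
  have -> : 4 = 2 ^+ 2 :> R by ring.
  by rewrite lerXn2r ?nnegrE.
have lower' : p * K / 2 - 80 * (N * r3) * p ^+ 2 - q / 8 * p^-1 <= L.
  rewrite -(ler_pM2l p0) mulrBr lerBlDr (le_trans lower)// lerD2l.
  by rewrite [leRHS]mulrCA mulfV ?mulr1// gt_eqF.
have Np : 80 * (N * r3) * p ^+ 2 <= 80 * (N * r3).
  rewrite -[leRHS]mulr1 ler_wpM2l ?mulr_ge0// -(expr1n _ 2) lerXn2r ?nnegrE//.
    exact: ltW.
  by case/andP: p01.
have qp : q / 8 * p^-1 <= q / 8 * 2 by rewrite ler_wpM2l// divr_ge0// ltW.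
have pK : p * K = K - q * K by rewrite /p; ring.
have qK : 0 <= q * K by rewrite mulr_ge0// ltW.
have NE : 320 * N * r3 = 320 * (N * r3) by ring.
rewrite NE ler_norml; move: upper lower' Kip; rewrite pK mulrDr mulr1 (mulrCA K).
rewrite (mulrC K q).
move: Nip Np qp qK Nr3 K0.
move: (K) (q * K) (N * r3) (80 * (N * r3) * p^-1 ^+ 2).
move: (80 * (N * r3) * p ^+ 2) (q / 8 * p^-1) (K * p^-1).
move=> k1 k2 k3 k4 k5 k6 k7 *; apply/andP; split; lra.
Qed.


End two_sample_ustat.

(** * Large deviations from a quadratic limiting cumulant *)

Lemma limn_esup_le_near {R : realType} (u : nat -> \bar R) (c : \bar R) :
  (\forall n \near \oo, u n <= c)%E -> (limn_esup u <= c)%E.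
Proof.
move=> uc; apply: (@le_trans _ _ (ereal_sup (u @` [set n | (u n <= c)%E]))).
  by apply: ereal_inf_lbound; exists [set n | (u n <= c)%E].
by apply: ge_ereal_sup => _ [n /= un <-].
Qed.

Lemma limn_einf_ge_near {R : realType} (u : nat -> \bar R) (c : \bar R) :
  (\forall n \near \oo, c <= u n)%E -> (c <= limn_einf u)%E.
Proof.
move=> uc; rewrite /limn_einf leeNr; apply: limn_esup_le_near.
by apply: filterS uc => n; rewrite leeN2.
Qed.

Lemma le_lne_speed {R : realType} (s c r : R) : 0 < s -> expR (s * c) <= r ->
  (c%:E <= s^-1%:E * lne r%:E)%E.
Proof.
move=> s0 cr; have r0 : 0 < r by exact: lt_le_trans (expR_gt0 _) cr.
rewrite lne_EFin// -EFinM lee_fin mulrC ler_pdivlMr// mulrC -ler_expR.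
by rewrite lnK ?posrE.
Qed.

Lemma lne_speed_le {R : realType} (s c r : R) : 0 < s -> 0 <= r ->
  r <= expR (s * c) -> (s^-1%:E * lne r%:E <= c%:E)%E.
Proof.
move=> s0 r0 rc; have [r0'|r0'] := leP r 0.
  by rewrite le0_lneNy ?lee_fin// gt0_muleNy ?leNye// lte_fin invr_gt0.
rewrite lne_EFin// -EFinM lee_fin mulrC ler_pdivrMr// mulrC -ler_expR.
by rewrite lnK ?posrE.
Qed.

Lemma lee_lt_real {R : realType} (x y : \bar R) :
  (forall c : R, (c%:E < x)%E -> (c%:E <= y)%E) -> (x <= y)%E.
Proof.
case: y => [y| |] H; last 2 first.
- exact: leey.
- case: x H => [x| |] H //.
    by have := H (x - 1); rewrite lte_fin gtrBl ltr01 => /(_ isT).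
  by have := H 0 (ltry 0).
case: x H => [x| |] H; last exact: leNye.
  rewrite lee_fin leNgt; apply/negP => yx.
  have := H ((x + y) / 2); rewrite lte_fin lee_fin {H} => H.
  have : (x + y) / 2 <= y by apply: H; lra.
  lra.
by have := H (y + 1) (ltry (y + 1)); rewrite lee_fin gerDl ler10.
Qed.

Lemma outer_prob_measurable {R : realType} {d : measure_display}
    {T : measurableType d} (P : probability T R) (A : set T) :
  measurable A -> outer_prob P A = P A.
Proof.
move=> mA; apply/eqP; rewrite eq_le; apply/andP; split.
  by apply: ereal_inf_lbound; exists A => //; split.
by apply: le_ereal_inf_tmp => _ [B [mB AB] <-]; apply: le_measure; rewrite ?inE.
Qed.

Lemma inner_prob_measurable {R : realType} {d : measure_display}
    {T : measurableType d} (P : probability T R) (A : set T) :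
  measurable A -> inner_prob P A = P A.
Proof.
move=> mA; apply/eqP; rewrite eq_le; apply/andP; split.
  by apply: ge_ereal_sup => _ [B [mB BA] <-]; apply: le_measure; rewrite ?inE.
by apply: ereal_sup_ubound; exists A => //; split.
Qed.

(** [D] is twice the limiting variance; when it vanishes the rate is that of a
    point mass at 0. *)
Definition quadratic_rate {R : realType} (D x : R) : \bar R :=
  if D == 0 then (if x == 0 then 0%E else +oo%E) else (x ^+ 2 / D)%:E.

Lemma quadratic_rate_function {R : realType} (D : R) : 0 <= D ->
  rate_function (S := R^o) (quadratic_rate D).
Proof.
move=> D0; rewrite /rate_function /quadratic_rate; split => [x|L].
  case: ifPn => _; first by case: ifPn => // _; rewrite leey.
  by rewrite lee_fin divr_ge0// sqr_ge0.
have [_|Dn0] := eqVneq D 0.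
  have [L0|L0] := leP 0 L.
    rewrite (_ : [set x | _] = [set 0]); first exact: compact_set1.
    apply/seteqP; split=> x /=; last by move=> ->; rewrite eqxx lee_fin.
    by case: eqVneq => [->|_]//; rewrite leye_eq.
  rewrite (_ : [set x | _] = set0); first exact: compact0.
  apply/seteqP; split=> x //=; case: eqVneq => [_|_]; last by rewrite leye_eq.
  by rewrite lee_fin leNgt L0.
have Dp : 0 < D by rewrite lt0r Dn0.
have [L0|L0] := leP 0 L.
  rewrite (_ : [set x | _] = `[- Num.sqrt (D * L), Num.sqrt (D * L)]%classic).
    exact: segment_compact.
  apply/seteqP; split=> x /=; rewrite lee_fin ler_pdivrMr// in_itv/= -ler_norml.
    by move=> xL; rewrite -sqrtr_sqr ler_wsqrtr// mulrC.
  move=> xL; rewrite mulrC -[leRHS]sqr_sqrtr ?mulr_ge0// -real_normK ?num_real//.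
  by rewrite lerXn2r ?nnegrE ?sqrtr_ge0.
rewrite (_ : [set x | _] = set0); first exact: compact0.
apply/seteqP; split=> x //=; rewrite lee_fin leNgt (lt_le_trans L0)//.
by rewrite divr_ge0// sqr_ge0.
Qed.

Section exponential_bounds.
Context {R : realType} {d : measure_display} {T : measurableType d}.
Variables (P : probability T R) (Z : T -> R).
Hypothesis bZ : bmeas Z.

Lemma prob_le_mgf (C : set R) (s t r : R) : measurable C -> 0 <= s -> 0 <= t ->
  C `<=` [set x | r <= `|x|] ->
  fine (P (Z @^-1` C)) <= expR (- (s * (t * r))) *
    (\int[P]_w expR (s * t * Z w) + \int[P]_w expR (s * - t * Z w)).
Proof.
move=> mC s0 t0 Cr.
have mZC : measurable (Z @^-1` C).
  by rewrite -[_ @^-1` _]setTI; case: bZ => mZ _; exact: mZ.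
have b1 u : bmeas (fun w => expR (s * u * Z w)) by exact/bmeas_expR/bmeasZ.
rewrite -Ex_indic// -ExD// -ExZ; last exact: bmeasD.
apply: Ex_le; [|exact/bmeasZ/bmeasD|].
  split; first exact: measurable_indic.
  by exists 1 => w; rewrite indicE; case: (_ \in _); rewrite ?normr0 ?normr1.
move=> w; rewrite indicE; case: (boolP (w \in _)) => [|_]; last first.
  by rewrite mulr_ge0 ?expR_ge0// addr_ge0 ?expR_ge0.
rewrite inE/= => /Cr/= rZ; rewrite mulrDr -!expRD.
have st0 : 0 <= s * t by rewrite mulr_ge0.
have h : s * (t * r) <= s * t * `|Z w| by rewrite mulrA ler_wpM2l.
have [Z0|Z0] := leP 0 (Z w).
  rewrite (ger0_norm Z0) in h.
  rewrite -[leLHS]addr0 lerD ?expR_ge0// -expR0 ler_expR.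
  by rewrite addrC subr_ge0.
rewrite (ltr0_norm Z0) in h.
rewrite -[leLHS]add0r lerD ?expR_ge0// -expR0 ler_expR.
by rewrite addrC subr_ge0 mulrN mulNr -mulrN.
Qed.

(** Exponential tilting as one pointwise inequality: where [|Z - x| < delta],
    the factor [expR (s * t * Z)] is at most
    [expR (s * (t * x + |t| * delta))], and elsewhere it is dominated by one of
    the two exponentials subtracted on the left, tilted by [t + u] or [t - u]. *)
Lemma prob_ge_mgf (C : set R) (s t u x delta : R) : measurable C ->
  0 <= s -> 0 <= u -> [set y | `|y - x| < delta] `<=` C ->
  \int[P]_w expR (s * t * Z w)
    - expR (- (s * (u * (x + delta)))) * \int[P]_w expR (s * (t + u) * Z w)
    - expR (s * (u * (x - delta))) * \int[P]_w expR (s * (t - u) * Z w)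
  <= expR (s * (t * x + `|t| * delta)) * fine (P (Z @^-1` C)).
Proof.
move=> mC s0 u0 Cx.
have mZC : measurable (Z @^-1` C).
  by rewrite -[_ @^-1` _]setTI; case: bZ => mZ _; exact: mZ.
have b1 v : bmeas (fun w => expR (s * v * Z w)) by exact/bmeas_expR/bmeasZ.
have bI : bmeas (\1_(Z @^-1` C) : T -> R).
  split; first exact: measurable_indic.
  by exists 1 => w; rewrite indicE; case: (_ \in _); rewrite ?normr0 ?normr1.
rewrite -Ex_indic// -!ExZ// -ExB//; last exact: bmeasZ.
rewrite -ExB//; [|by apply/bmeasB => //; exact: bmeasZ|exact: bmeasZ].
apply: Ex_le => [||w].
- by apply/bmeasB; [apply/bmeasB => //; exact: bmeasZ|exact: bmeasZ].
- exact: bmeasZ.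
rewrite -!expRD indicE; have [Zx|Zx] := ltP `|Z w - x| delta.
  rewrite mem_set ?mulr1; last exact: Cx.
  apply: (@le_trans _ _ (expR (s * t * Z w))).
    by rewrite lerBlDr lerBlDr -addrA lerDl addr_ge0 ?expR_ge0.
  rewrite ler_expR -mulrA ler_wpM2l//.
  have : t * (Z w - x) <= `|t| * delta.
    rewrite (le_trans (ler_norm _))// normrM ler_wpM2l//; exact: ltW.
  by rewrite mulrBr; lra.
apply: (@le_trans _ _ 0); last by rewrite mulr_ge0 ?expR_ge0.
have su0 : 0 <= s * u by rewrite mulr_ge0.
move: Zx; rewrite ler_normr => /orP[Zx|Zx].
  have h : 0 <= s * u * (Z w - x - delta).
    by rewrite mulr_ge0//; lra.
  rewrite lerBlDr add0r -[leRHS]add0r (le_trans _ (lerD (lexx _) (expR_ge0 _)))//.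
  rewrite addr0 subr_le0 ler_expR -subr_ge0.
  by rewrite (_ : _ - _ = s * u * (Z w - x - delta))//; ring.
have h : 0 <= s * u * (x - delta - Z w).
  by rewrite mulr_ge0//; lra.
rewrite lerBlDr add0r lerBlDr -[leLHS]addr0 lerD ?expR_ge0//.
rewrite ler_expR -subr_ge0.
by rewrite (_ : _ - _ = s * u * (x - delta - Z w))//; ring.
Qed.

End exponential_bounds.

(** The exponents met when tilting by a [t] at which the quadratic cumulant has
    slope [x]: compared with the mass of the tilted measure, a further shift by
    [u] in either direction loses [4 * S * eta]. *)
Lemma tilt_exponents {R : realType} (D S t x u delta eta : R) :
  0 <= S -> D * t = 2 * x -> D * u ^+ 2 <= u * delta -> 0 < u * delta ->
  eta = u * delta / 8 ->
  - (S * (u * (x + delta))) + S * (D * (t + u) ^+ 2 / 4 + eta) <=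
    S * (D * t ^+ 2 / 4 - eta) + - (4 * (S * eta)) /\
  S * (u * (x - delta)) + S * (D * (t - u) ^+ 2 / 4 + eta) <=
    S * (D * t ^+ 2 / 4 - eta) + - (4 * (S * eta)).
Proof.
move=> S0 Dt Duu ud0 etaE.
have main : 0 <= S * (u * delta - 6 * eta - D * u ^+ 2 / 4).
  rewrite mulr_ge0// etaE.
  by move: (D * u ^+ 2) (u * delta) Duu ud0 => b1 b2; lra.
have xE : x = D * t / 2 by rewrite Dt; field.
by split; rewrite -subr_ge0 xE; apply: le_trans main _; rewrite le_eqVlt;
  apply/orP; left; apply/eqP; field.
Qed.

Lemma tilt_error {R : realType} (a b c dl e : R) : 0 < c -> c <= dl -> dl + b <= e ->
  a + b + (- (a / 2) - e) <= 2 * a / 4 - c / 8 - c / 8.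
Proof. lra. Qed.

Lemma expRN4_le {R : realType} (y : R) : 1 <= y -> expR (- (4 * y)) <= 4^-1.
Proof.
move=> y1; rewrite expRN lef_pV2 ?posrE ?expR_gt0//.
by apply: le_trans (expR_ge1Dx _); lra.
Qed.

Lemma expRN_le_half {R : realType} (y : R) : 1 <= y -> expR (- y) <= 2^-1.
Proof.
move=> y1; rewrite expRN lef_pV2 ?posrE ?expR_gt0//.
by apply: le_trans (expR_ge1Dx _); lra.
Qed.

Section LDP_of_cumulant.
Context {R : realType} {d : nat -> measure_display}.
Context {T : forall n, measurableType (d n)}.
Variables (P : forall n, probability (T n) R) (Z : forall n, T n -> R).
Variables (s : nat -> R) (D : R).
Hypotheses (bZ : forall n, bmeas (@Z n)) (D0 : 0 <= D).
Hypothesis s_gt0 : forall n, (0 < n)%N -> 0 < s n.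
Hypothesis s_cvgy : s n @[n --> \oo] --> +oo.

Let M n t := \int[P n]_w expR (s n * t * Z w).

Hypothesis cumulant_cvg : forall t,
  (s n)^-1 * ln (M n t) @[n --> \oo] --> D * t ^+ 2 / 4.

Let M_gt0 n t : 0 < M n t.
Proof. exact/Ex_expR_gt0/bmeasZ. Qed.

Let M_near t e : 0 < e -> \forall n \near \oo,
  expR (s n * (D * t ^+ 2 / 4 - e)) <= M n t <= expR (s n * (D * t ^+ 2 / 4 + e)).
Proof.
move=> e0; have /cvgrPdist_le/(_ e e0) := @cumulant_cvg t.
apply: filter_app; near=> n.
have sn : 0 < s n by apply: s_gt0; near: n; exact: nbhs_infty_gt.
rewrite distrC ler_norml lerBrDr lerBlDr => /andP[h1 h2].
rewrite -[M n t]lnK ?posrE// !ler_expR.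
have -> : ln (M n t) = s n * ((s n)^-1 * ln (M n t)) by rewrite mulVKf// gt_eqF.
by rewrite !ler_pM2l//; apply/andP; split; lra.
Unshelve. all: by end_near. Qed.

Let prob_EFin n A : measurable A -> P n A = (fine (P n A))%:E.
Proof. by move=> mA; rewrite fineK// fin_num_measure. Qed.

Let mZ n C : measurable C -> measurable (@Z n @^-1` C).
Proof. by move=> mC; rewrite -[_ @^-1` _]setTI; case: (bZ n) => mZ _; exact: mZ. Qed.

(** Chernoff's inequality with parameter [t] on both half-lines. *)
Lemma cumulant_upper (C : set R) (c r t : R) : measurable C -> 0 <= t ->
  C `<=` [set x | r <= `|x|] -> c <= t * r - D * t ^+ 2 / 4 ->
  (limn_esup (fun n => (s n)^-1%:E * lne (outer_prob (P n) (@Z n @^-1` C)))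
    <= (- c)%:E)%E.
Proof.
move=> mC t0 Cr cle; apply/lee_addgt0Pr => e e0; rewrite -EFinD.
apply: limn_esup_le_near.
have e2 : 0 < e / 2 by rewrite divr_gt0.
have Mp := @M_near t _ e2; have Mm := @M_near (- t) _ e2.
near=> n.
have sn : 0 < s n by apply: s_gt0; near: n; exact: nbhs_infty_gt.
have se : 2 / e <= s n by near: n; exact: (cvgryPge s).1.
rewrite outer_prob_measurable; last exact: mZ.
rewrite prob_EFin; last exact: mZ.
apply: lne_speed_le => //; first exact: fine_ge0.
apply: (le_trans (prob_le_mgf (P n) (bZ n) mC (ltW sn) t0 Cr)).
have /andP[_ h1] : expR (s n * (D * t ^+ 2 / 4 - e / 2)) <= M n t <=
  expR (s n * (D * t ^+ 2 / 4 + e / 2)) by near: n.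
have /andP[_ h2] : expR (s n * (D * (- t) ^+ 2 / 4 - e / 2)) <= M n (- t) <=
  expR (s n * (D * (- t) ^+ 2 / 4 + e / 2)) by near: n.
rewrite sqrrN in h2.
apply: (le_trans (ler_wpM2l (expR_ge0 _) (lerD h1 h2))).
rewrite -[X in _ * X]mulr2n -[X in _ * X]mulr_natl mulrCA -expRD.
have two : 2 <= expR (s n * (e / 2)).
  apply: le_trans (expR_ge1Dx _).
  have : 2 / e * (e / 2) <= s n * (e / 2) by rewrite ler_pM2r.
  have -> : 2 / e * (e / 2) = 1 by field; rewrite gt_eqF.
  lra.
apply: (le_trans (ler_wpM2r (expR_ge0 _) two)).
rewrite -expRD ler_expR -mulrN -!mulrDr ler_pM2l//.
by lra.
Unshelve. all: by end_near. Qed.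

(** The condition on [t] says that the quadratic cumulant has slope [x] at [t].
    It has a solution for every [x] when [D] is positive, and for [x = 0] when
    [D = 0]; these are the points where the rate is finite. *)
Lemma cumulant_lower (U : set R) (x t : R) : measurable U -> open U -> U x ->
  D * t = 2 * x ->
  ((- (t * x / 2))%:E <=
    limn_einf (fun n => (s n)^-1%:E * lne (inner_prob (P n) (@Z n @^-1` U))))%E.
Proof.
move=> mU oU Ux Dt.
have [dl /= dl0 xU] : exists2 e : R, 0 < e & ball x e `<=` U.
  by have /nbhs_ballP[e e0 eU] := open_nbhs_nbhs (conj oU Ux); exists e.
apply/lee_subgt0Pr => e e0; rewrite -EFinB; apply: limn_einf_ge_near.
have t1 : 0 < 1 + `|t| by rewrite ltr_pwDl.
pose delta := Num.min dl (Num.min 1 (e / (1 + `|t|))).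
have delta0 : 0 < delta by rewrite !lt_min dl0 ltr01/= divr_gt0.
have delta1 : delta <= 1 by rewrite !ge_min lexx orbT.
have deltae : delta * (1 + `|t|) <= e.
  by rewrite -ler_pdivlMr// !ge_min lexx !orbT.
have Udelta : [set y | `|y - x| < delta] `<=` U.
  move=> y /= yx; apply: xU; rewrite /ball/= distrC (lt_le_trans yx)//.
  by rewrite ge_min lexx.
have D1 : 0 < D + 1 by rewrite ltr_wpDl.
(* This shift makes the quadratic gain [D * u ^+ 2 / 4] at most a quarter of
   the linear loss [u * delta]. *)
pose u := delta / (D + 1).
have u0 : 0 < u by rewrite divr_gt0.
have uD : u * (D + 1) = delta by rewrite /u mulfVK// gt_eqF.
have udelta : u <= delta by rewrite -uD ler_peMr ?(ltW u0)// lerDr.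
pose eta := u * delta / 8.
have ud0 : 0 < u * delta by rewrite mulr_gt0.
have eta0 : 0 < eta by rewrite /eta divr_gt0.
have udd : u * delta <= delta by rewrite ler_piMl ?(ltW delta0)// (le_trans udelta).
have Duu : D * u ^+ 2 <= u * delta.
  have -> : D * u ^+ 2 = u * (u * D) by ring.
  by rewrite ler_pM2l// -uD mulrDr mulr1 lerDl ltW.
have M0 := @M_near t _ eta0; have Mp := @M_near (t + u) _ eta0.
have Mm := @M_near (t - u) _ eta0.
near=> n.
have sn : 0 < s n by apply: s_gt0; near: n; exact: nbhs_infty_gt.
have seta : eta^-1 <= s n by near: n; exact: (cvgryPge s).1.
have se1 : 1 <= s n * eta by rewrite -ler_pdivrMr// div1r.
rewrite inner_prob_measurable; last exact: mZ.
rewrite prob_EFin; last exact: mZ.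
apply: le_lne_speed => //.
have /andP[h1 _] : expR (s n * (D * t ^+ 2 / 4 - eta)) <= M n t <=
  expR (s n * (D * t ^+ 2 / 4 + eta)) by near: n.
have /andP[_ h2] : expR (s n * (D * (t + u) ^+ 2 / 4 - eta)) <= M n (t + u) <=
  expR (s n * (D * (t + u) ^+ 2 / 4 + eta)) by near: n.
have /andP[_ h3] : expR (s n * (D * (t - u) ^+ 2 / 4 - eta)) <= M n (t - u) <=
  expR (s n * (D * (t - u) ^+ 2 / 4 + eta)) by near: n.
have := prob_ge_mgf (P n) (bZ n) t mU (ltW sn) (ltW u0) Udelta.
rewrite -/(M n t) -/(M n (t + u)) -/(M n (t - u)).
set p := fine _ => hp.
pose E := expR (s n * (D * t ^+ 2 / 4 - eta)).
have small : expR (- (4 * (s n * eta))) <= 4^-1 by exact: expRN4_le.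
have k2 : expR (- (s n * (u * (x + delta)))) * M n (t + u) <= E / 4.
  apply: (le_trans (ler_wpM2l (expR_ge0 _) h2)).
  apply: (@le_trans _ _ (E * expR (- (4 * (s n * eta))))); last first.
    by rewrite ler_wpM2l ?expR_ge0.
  rewrite /E -!expRD ler_expR.
  by case: (@tilt_exponents _ D (s n) t x u delta eta (ltW sn) Dt Duu ud0 erefl).
have k3 : expR (s n * (u * (x - delta))) * M n (t - u) <= E / 4.
  apply: (le_trans (ler_wpM2l (expR_ge0 _) h3)).
  apply: (@le_trans _ _ (E * expR (- (4 * (s n * eta))))); last first.
    by rewrite ler_wpM2l ?expR_ge0.
  rewrite /E -!expRD ler_expR.
  by case: (@tilt_exponents _ D (s n) t x u delta eta (ltW sn) Dt Duu ud0 erefl).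
have k1 : E <= M n t by [].
have half : E / 2 <= expR (s n * (t * x + `|t| * delta)) * p.
  apply: le_trans hp; have -> : E / 2 = E - E / 4 - E / 4 by field.
  by rewrite lerB// lerB.
have e2 : expR (- (s n * eta)) <= 2^-1 by exact: expRN_le_half.
rewrite -(ler_pM2l (expR_gt0 (s n * (t * x + `|t| * delta)))).
apply: le_trans half.
apply: (@le_trans _ _ (E * expR (- (s n * eta)))); last first.
  by rewrite ler_wpM2l ?expR_ge0.
rewrite /E -!expRD ler_expR -[- (s n * eta)]mulrN -!mulrDr.
apply: ler_wpM2l; first exact: ltW.
have Dtt : D * t ^+ 2 = 2 * (t * x) by rewrite expr2 mulrA Dt; ring.
rewrite mulrDr mulr1 (mulrC delta) in deltae.
by rewrite Dtt /eta; exact: tilt_error ud0 udd deltae.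
Unshelve. all: by end_near. Qed.

(** The Gartner-Ellis argument in one dimension, for a limiting cumulant that
    may be degenerate. *)
Theorem LDP_of_cumulant :
  LDP (S := R^o) (@measurable _ R) P (@Z) s (quadratic_rate D).
Proof.
split.
- by split.
- exact: quadratic_rate_function.
- move=> U oU mU; rewrite leeNl; apply: le_ereal_inf_tmp => _ [x Ux <-].
  rewrite leeNl /quadratic_rate; have [DE|Dn0] := eqVneq D 0.
    have [xE|_] := eqVneq x 0; last by rewrite leNye.
    have := @cumulant_lower U x 0 mU oU Ux.
    by rewrite xE DE !mulr0 mul0r oppr0 oppe0; exact.
  have := @cumulant_lower U x (2 * x / D) mU oU Ux.
  rewrite mulrC mulfVK// => /(_ erefl).
  suff -> : - (2 * x / D * x / 2) = - (x ^+ 2 / D) by [].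
  by field.
move=> C cC mC; rewrite leeNr; apply: lee_lt_real => c cI; rewrite leeNr.
have CI x : C x -> (c%:E < quadratic_rate D x)%E.
  by move=> Cx; apply: lt_le_trans cI _; apply: ereal_inf_lbound; exists x.
have [c0|c0] := ltP c 0.
  apply: (@cumulant_upper C c 0 0) => //.
    by move=> x _ /=.
  by rewrite mul0r expr0n/= mulr0 mul0r subr0 ltW.
have [DE|Dn0] := eqVneq D 0.
  have C0 : ~ C 0.
    by move=> /CI; rewrite /quadratic_rate DE !eqxx lte_fin ltNge c0.
  have [r r0 Cr] : exists2 r : R, 0 < r & C `<=` [set x | r <= `|x|].
    have : nbhs (0 : R^o) (~` C) by apply: open_nbhs_nbhs; split => //; exact: closed_openC.
    move=> /nbhs_ballP[r /= r0 rC]; exists r => // x Cx /=.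
    rewrite leNgt; apply/negP => xr; apply: (rC x _ Cx).
    by rewrite /ball/= sub0r normrN.
  (* Without variance the exponential rate is arbitrary: [t] is chosen to
     reach [c]. *)
  apply: (@cumulant_upper C c r (c / r)) => //.
    by rewrite divr_ge0// ltW.
  by rewrite DE mul0r mul0r subr0 mulfVK// gt_eqF.
have Dp : 0 < D by rewrite lt0r Dn0.
have Dc0 : 0 <= D * c by rewrite mulr_ge0.
have sD : Num.sqrt (D * c) ^+ 2 = D * c by rewrite sqr_sqrtr.
apply: (@cumulant_upper C c (Num.sqrt (D * c)) (2 * Num.sqrt (D * c) / D)) => //.
- by rewrite divr_ge0// mulr_ge0// sqrtr_ge0.
- move=> x /CI; rewrite /quadratic_rate (negbTE Dn0) lte_fin ltr_pdivlMr// => cx /=.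
  by rewrite -sqrtr_sqr ler_wsqrtr// mulrC ltW.
- have -> : 2 * Num.sqrt (D * c) / D * Num.sqrt (D * c) -
    D * (2 * Num.sqrt (D * c) / D) ^+ 2 / 4 = Num.sqrt (D * c) ^+ 2 / D by field.
  by rewrite sD mulrAC mulfV// mul1r.
Qed.

End LDP_of_cumulant.

(** * Moderate deviations of two-sample U-statistics *)

Lemma ustat_error_split {R : realType} (x y z e : R) :
  x <= e / 4 -> y <= e / 4 -> z <= e / 4 -> x + y + z + e / 4 <= e.
Proof. lra. Qed.

Section moderate_deviations.
Context {R : realType}.
Variables (a : R -> R) (m : nat -> nat) (lambda : R).
Hypotheses (a_gt0 : forall t, 0 < t -> 0 < a t)
  (a_cvgy : a t @[t --> +oo] --> +oo)
  (a_small : a t / Num.sqrt t @[t --> +oo] --> 0)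
  (m_gt0 : forall n, (0 < n)%N -> (0 < m n)%N)
  (lambda01 : 0 < lambda < 1)
  (m_cvg : (m n)%:R / (m n + n)%:R @[n --> \oo] --> lambda).

Let N n : R := (m n * n)%:R / (m n + n)%:R.
Let l n : R := (m n)%:R / (m n + n)%:R.

Lemma effective_size_gt0 n : (0 < n)%N -> 0 < N n.
Proof.
by move=> n0; rewrite /N divr_gt0// ltr0n ?muln_gt0 ?addn_gt0 ?n0 ?orbT// m_gt0.
Qed.

Lemma effective_size_cvgy : N n @[n --> \oo] --> +oo.
Proof.
have /andP[l0 _] := lambda01.
apply/cvgryPge => A.
have := m_cvg => /cvgrPdist_le/(_ (lambda / 2)).
rewrite divr_gt0// => /(_ isT).
apply: filter_app; near=> n => hl.
have nA : A / (lambda / 2) <= n%:R by near: n; exact: nbhs_infty_ger.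
have l2 : lambda / 2 <= l n.
  by move: hl; rewrite -/(l n) ler_norml => /andP[_]; lra.
have -> : N n = l n * n%:R by rewrite /N /l natrM mulrAC.
rewrite ler_pdivrMr ?divr_gt0// mulrC in nA.
by apply: (le_trans nA); rewrite ler_wpM2r.
Unshelve. all: by end_near. Qed.

Lemma speed_cvgy : a (N n) ^+ 2 @[n --> \oo] --> +oo.
Proof.
have aN : a (N n) @[n --> \oo] --> +oo.
  exact: (cvg_comp _ _ effective_size_cvgy a_cvgy).
apply/cvgryPge => A; near=> n.
have a1 : 1 <= a (N n) by near: n; exact: (cvgryPge _).1.
have aA : A <= a (N n) by near: n; exact: (cvgryPge _).1.
by rewrite (le_trans aA)// expr2 ler_peMl// (le_trans ler01).
Unshelve. all: by end_near. Qed.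

Context {d : nat -> measure_display} {T : forall n, measurableType (d n)}.
Variables (P : forall n, probability (T n) R).
Variables (Xs : forall n, 'I_(m n) -> {RV (P n) >-> R}).
Variables (Ys : forall n, 'I_n -> {RV (P n) >-> R}).
Hypotheses (indX : forall n, mutually_independent (@Xs n))
  (indY : forall n, mutually_independent (@Ys n))
  (indXY : forall n, independent_samples (@Xs n) (@Ys n)).
Variables (h : R * R -> R) (h1 h2 : R -> R) (theta v1 v2 : R).
Hypotheses (mh : measurable_fun [set: R * R] h)
  (mh1 : measurable_fun [set: R] h1) (mh2 : measurable_fun [set: R] h2).
Hypotheses (hb : forall z, `|h z| <= 1) (h1b : forall x, `|h1 x| <= 1)
  (h2b : forall y, `|h2 y| <= 1) (thetab : `|theta| <= 1).
Hypothesis hX : forall n i y, \int[P n]_w h (@Xs n i w, y) = h2 y.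
Hypothesis hY : forall n j x, \int[P n]_w h (x, @Ys n j w) = h1 x.
Hypothesis h1X : forall n i, \int[P n]_w h1 (@Xs n i w) = theta.
Hypothesis h2Y : forall n j, \int[P n]_w h2 (@Ys n j w) = theta.
Hypothesis v1E : forall n i, \int[P n]_w ((h1 (@Xs n i w) - theta) ^+ 2) = v1.
Hypothesis v2E : forall n j, \int[P n]_w ((h2 (@Ys n j w) - theta) ^+ 2) = v2.

Let W n (w : T n) : R := ((m n)%:R * n%:R)^-1 *
  \sum_(i < m n) \sum_(j < n) h (@Xs n i w, @Ys n j w).
Let Z n (w : T n) : R := Num.sqrt (N n) / a (N n) * (W w - theta).

Let v1_ge0 : 0 <= v1.
Proof.
by rewrite -(@v1E 1 (Ordinal (@m_gt0 1 isT))); apply: Rintegral_ge0 => *; exact: sqr_ge0.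
Qed.

Let v2_ge0 : 0 <= v2.
Proof.
by rewrite -(@v2E 1 ord0); apply: Rintegral_ge0 => *; exact: sqr_ge0.
Qed.

(** With [r = t * a (N) / sqrt N] the exponent is [r * N * (W - theta)], and
    [N * r ^+ 2 = t ^+ 2 * s] where [s] is the speed. After division by [s] the
    error of [ln_mgf_ustat] is at most a constant times [q + |r| + s^-1], with
    [q] arbitrarily small, [r] tending to 0 and [s] to infinity. *)
Lemma ustat_cumulant t : (a (N n) ^+ 2)^-1 *
    ln (\int[P n]_w expR (a (N n) ^+ 2 * t * Z w)) @[n --> \oo] -->
  2 * (lambda * v2 + (1 - lambda) * v1) * t ^+ 2 / 4.
Proof.
pose w n := (1 - l n) * v1 + l n * v2.
have wcvg : w n @[n --> \oo] --> lambda * v2 + (1 - lambda) * v1.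
  rewrite addrC; apply: cvgD.
    by apply: cvgMl; apply: cvgB => //; exact: cvg_cst.
  exact: cvgMl.
apply/cvgrPdist_le => e e0.
have t20 : 0 <= t ^+ 2 := sqr_ge0 t.
have vv0 : 0 <= v1 + v2 by rewrite addr_ge0.
have B0 : 0 < 1 + t ^+ 2 * (v1 + v2) by rewrite ltr_pwDl// mulr_ge0.
pose q := Num.min (2^-1) (e / 4 / (1 + t ^+ 2 * (v1 + v2))).
have q0 : 0 < q by rewrite lt_min invr_gt0 ltr0n/= !divr_gt0.
have q2 : q <= 2^-1 by rewrite ge_min lexx.
have qe : q * (1 + t ^+ 2 * (v1 + v2)) <= e / 4.
  by rewrite -ler_pdivlMr// ge_min lexx orbT.
have rho0 : a (N n) / Num.sqrt (N n) @[n --> \oo] --> 0.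
  exact: (cvg_comp _ _ effective_size_cvgy a_small).
have r0 : t * (a (N n) / Num.sqrt (N n)) @[n --> \oo] --> 0.
  by rewrite -(mulr0 t); exact: cvgMr.
have tw : t ^+ 2 / 2 * w n @[n --> \oo] -->
    t ^+ 2 / 2 * (lambda * v2 + (1 - lambda) * v1) by exact: cvgMr.
have C0 : 0 < 1 + 320 * t ^+ 2.
  exact: (ltr_pwDl ltr01 (mulr_ge0 (ler0n R 320) t20)).
have e1 : 0 < e / 4 / (1 + 320 * t ^+ 2).
  exact: (divr_gt0 (divr_gt0 e0 _) C0).
have q64 : 0 < q / 64 by rewrite divr_gt0.
have e4 : 0 < e / 4 by rewrite divr_gt0.
have /cvgrPdist_le/(_ _ q64) near1 := r0.
have /cvgrPdist_le/(_ _ e1) near2 := r0.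
have /cvgrPdist_le/(_ _ e4) near3 := tw.
have /cvgryPge/(_ e^-1) near4 := speed_cvgy.
near=> n.
have n0 : (0 < n)%N by near: n; exact: nbhs_infty_gt.
have N0 := effective_size_gt0 n0.
have m0 := m_gt0 n0.
have a0 : 0 < a (N n) by exact: a_gt0.
have se : e^-1 <= a (N n) ^+ 2 by near: n; exact: near4.
set s := a (N n) ^+ 2 in se *; have s0 : 0 < s by rewrite exprn_gt0.
pose r := t * (a (N n) / Num.sqrt (N n)).
have hq : `|r| <= q / 64.
  by rewrite -normrN -sub0r /r; near: n; exact: near1.
have hr : `|r| <= e / 4 / (1 + 320 * t ^+ 2).
  by rewrite -normrN -sub0r /r; near: n; exact: near2.
have hw : `|t ^+ 2 / 2 * (lambda * v2 + (1 - lambda) * v1) - t ^+ 2 / 2 * w n| <= e / 4.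
  by near: n; exact: near3.
have sN0 : 0 < Num.sqrt (N n) by rewrite sqrtr_gt0.
have NE : (m n)%:R * n%:R / ((m n)%:R + n%:R) = N n by rewrite /N natrM natrD.
have lE : (m n)%:R / ((m n)%:R + n%:R) = l n by rewrite /l natrD.
have sqN : Num.sqrt (N n) ^+ 2 = N n by rewrite sqr_sqrtr ?ltW.
have Nr2 : N n * r ^+ 2 = t ^+ 2 * s.
  rewrite -{1}sqN /r /s; move: (a (N n)) => y.
  by field; rewrite gt_eqF.
have qq : 0 < q <= 2^-1 by rewrite q0.
have := @ln_mgf_ustat _ _ _ (P n) (m n) n (@Xs n) (@Ys n) (@indX n) (@indY n)
  (@indXY n) m0 n0 h h1 h2 theta v1 v2 mh mh1 mh2 hb h1b h2b thetab
  (@hX n) (@hY n) (@h1X n) (@h2Y n) (@v1E n) (@v2E n) q r qq hq.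
rewrite NE lE -/(w n).
have -> : \int[P n]_w0 expR (r * N n * (((m n)%:R * n%:R)^-1 *
     (\sum_(i < m n) \sum_(j < n) h (Xs i w0, Ys j w0)) - theta)) =
   \int[P n]_w expR (s * t * Z w).
  apply: eq_Rintegral => x _; congr expR; rewrite /Z -/(W x).
  rewrite -{1}sqN /r /s; move: (W x - theta) (a (N n)) a0 => z y y0.
  by field; rewrite !gt_eqF.
set L := ln _.
have w0 : 0 <= w n <= v1 + v2.
  have l0 : 0 <= l n by rewrite /l divr_ge0.
  have l1 : l n <= 1.
    by rewrite /l ler_pdivrMr ?ltr0n ?addn_gt0 ?m0// mul1r ler_nat leq_addr.
  rewrite /w; apply/andP; split; first by rewrite addr_ge0// mulr_ge0// subr_ge0.
  by apply: lerD; apply: ler_piMl => //; rewrite lerBlDr lerDl.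
have NR3 : N n * `|r| ^+ 3 = t ^+ 2 * s * `|r|.
  by rewrite exprSr mulrA real_normK ?num_real// Nr2.
rewrite -[320 * N n * _]mulrA NR3 Nr2.
have -> : t ^+ 2 * s * w n / 2 = s * (t ^+ 2 / 2 * w n) by ring.
have -> : q * (t ^+ 2 * s * w n) + 320 * (t ^+ 2 * s * `|r|) + 4^-1 =
   s * (q * (t ^+ 2 * w n) + 320 * t ^+ 2 * `|r| + (4 * s)^-1).
  by move: `|r| (w n) => y z; field; rewrite gt_eqF.
have -> : L - s * (t ^+ 2 / 2 * w n) = s * (s^-1 * L - t ^+ 2 / 2 * w n).
  by rewrite mulrBr mulVKf// gt_eqF.
rewrite normrM (gtr0_norm s0) ler_pM2l// => main.
have -> : 2 * (lambda * v2 + (1 - lambda) * v1) * t ^+ 2 / 4 =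
  t ^+ 2 / 2 * (lambda * v2 + (1 - lambda) * v1) by field.
rewrite distrC -[s^-1 * L](subrK (t ^+ 2 / 2 * w n)) -addrA.
apply: (le_trans (ler_normD _ _)).
rewrite distrC in hw; apply: (le_trans (lerD main hw)).
have k1 : q * (t ^+ 2 * w n) <= e / 4.
  apply: le_trans qe; rewrite ler_pM2l//.
  apply: (@le_trans _ _ (t ^+ 2 * (v1 + v2))); last by rewrite lerDr.
  by rewrite ler_wpM2l//; case/andP: w0.
have k2 : 320 * t ^+ 2 * `|r| <= e / 4.
  rewrite (ler_pdivlMr _ _ C0) in hr.
  by apply: le_trans hr; rewrite mulrC ler_wpM2l// lerDr.
have k3 : (4 * s)^-1 <= e / 4.
  have -> : (4 * s)^-1 = s^-1 / 4 by rewrite [4 * s]mulrC [LHS]invfM.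
  by rewrite ler_wpM2r// -[e]invrK lef_pV2// posrE invr_gt0.
by apply: ustat_error_split k1 k2 k3.
Unshelve. all: by end_near. Qed.

Theorem ustat_LDP : LDP (S := R^o) (@measurable _ R) P (@Z)
  (fun n => a (N n) ^+ 2) (quadratic_rate (2 * (lambda * v2 + (1 - lambda) * v1))).
Proof.
have /andP[l0 l1] := lambda01.
apply: LDP_of_cumulant.
- move=> n; apply/bmeasZ/bmeasB/bmeas_cst/bmeasZ/bmeas_sum => i _.
  apply: bmeas_sum => j _; apply: (@bmeas_comp _ _ _ _ _ h).
    by split => //; exists 1.
  exact: measurable_fun_pair.
- by rewrite mulr_ge0// addr_ge0// mulr_ge0// ?ltW// subr_gt0.
- by move=> n n0; rewrite exprn_gt0// a_gt0// effective_size_gt0.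
- exact: speed_cvgy.
- exact: ustat_cumulant.
Qed.

End moderate_deviations.

(** * The Wilcoxon statistic *)

Section stieltjes_integrals.
Context {R : realType}.

Lemma lebesgue_stieltjes_measureE (g : cumulative R R)
    (mu : {measure set (measurableTypeR R) -> \bar R}) :
  (forall a b, a <= b -> mu `]a, b]%classic = (g b - g a)%:E) ->
  forall A, measurable A -> lebesgue_stieltjes_measure g A = mu A.
Proof.
move=> muE; apply: lebesgue_stieltjes_measure_unique => I [[a b]]/= _ <-.
rewrite /lebesgue_stieltjes_measure /measure_extension/=.
rewrite measurable_mu_extE/=; last exact: is_ocitv.
have [ab|ba] := leP a b; first by rewrite wlength_itv_bnd// muE.
by rewrite set_itv_ge ?wlength0 ?measure0// bnd_simp -leNgt ltW.
Qed.

Lemma stieltjes_law {d : measure_display} {T : measurableType d}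
    (P : probability T R) (X : {RV P >-> R}) (g : cumulative R R) (f : R -> R) :
  (forall x, cdf X x = (g x)%:E) -> bmeas f -> (forall x, 0 <= f x) ->
  stieltjes f g = \int[P]_w f (X w).
Proof.
move=> Xg bf f0; rewrite /stieltjes /Rintegral; congr fine.
(* [R] and [measurableTypeR R] carry the same sigma-algebra under different
   displays. *)
have mX : measurable_fun [set: T] (X : T -> measurableTypeR R).
  exact: (measurable_funP X).
pose X' : {mfun T >-> measurableTypeR R} :=
  HB.pack (X : T -> measurableTypeR R) (isMeasurableFun.Build _ _ _ _ _ mX).
have mf : measurable_fun [set: measurableTypeR R] (EFin \o f).
  by have /measurable_EFinP := proj1 bf.
transitivity (\int[distribution P X']_x (f x)%:E)%E; last first.
  by rewrite (ge0_integral_distribution X' mf)// => x; rewrite lee_fin.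
apply: eq_measure_integral => A mA _.
apply: lebesgue_stieltjes_measureE => // a b ab.
rewrite EFinB -!Xg -[LHS]/(distribution P X `]a, b]).
have -> : `]a, b]%classic = `]-oo, b] `\` `]-oo, a].
  by rewrite -[RHS]setCK setCD setCitvl setUC -[LHS]setCK setCitv.
rewrite measureD ?setIidr//; first exact: subset_itvl.
by rewrite -ge0_fin_numE// fin_num_measure.
Qed.

Lemma stieltjes_ecdf n (y : 'I_n -> R) (f : R -> R) :
  bmeas f -> (forall x, 0 <= f x) ->
  stieltjes f (ecdf y : cumulative R R) = n%:R^-1 * \sum_(j < n) f (y j).
Proof.
move=> bf f0.
have mf : measurable_fun [set: measurableTypeR R] (EFin \o f).
  by have /measurable_EFinP := proj1 bf.
have f0' (x : measurableTypeR R) : [set: measurableTypeR R] x -> (0 <= (f x)%:E)%E.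
  by move=> _; rewrite lee_fin.
have n0 : 0 <= n%:R^-1 :> R by rewrite invr_ge0.
(* Sums of measures are indexed by [nat]; the value 0 is never reached. *)
pose y' k := if insub k is Some j then y j else 0.
have y'E (j : 'I_n) : y' j = y j by rewrite /y' valK.
pose mu := mscale (NngNum n0)
  (msum (fun k => @dirac _ (measurableTypeR R) (y' k) R :
     {measure set (measurableTypeR R) -> \bar R}) n).
rewrite /stieltjes /Rintegral; transitivity (fine (\int[mu]_x (f x)%:E)%E); last first.
  rewrite /mu ge0_integral_mscale//.
  rewrite ge0_integral_measure_sum//.
  under eq_bigr do rewrite integral_dirac//= diracT mul1e y'E.
  by rewrite sumEFin.
congr fine; apply: eq_measure_integral => A mA _.
apply: lebesgue_stieltjes_measureE => // a b ab.
rewrite /mu /mscale/= /msum/= /ecdf -mulrBr EFinM -sumrB -sumEFin; congr (_ * _)%E.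
apply: eq_bigr => j _.
rewrite -[LHS]/(@dirac _ (measurableTypeR R) (y' j) R `]a, b]%classic).
rewrite diracE y'E; congr EFin.
have [yb|yb] := leP (y j) b; have [ya|ya] := leP (y j) a.
- by rewrite memNset ?subrr//= in_itv/= ltNge ya.
- by rewrite mem_set ?subr0//= in_itv/= ya yb.
- by have := lt_le_trans yb (le_trans ya ab); rewrite ltxx.
- by rewrite memNset ?subrr//= in_itv/= ya leNgt yb.
Qed.

End stieltjes_integrals.

Section left_limits.
Context {R : realType} {d : measure_display} {T : measurableType d}.
Variables (P : probability T R) (X : {RV P >-> R}) (g : cumulative R R).
Hypothesis Xg : forall x, cdf X x = (g x)%:E.

Let mle x : measurable [set w | X w <= x].
Proof. by rewrite -preimage_itvNyc; exact: measurable_funPTI. Qed.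

Let mge x : measurable [set w | x <= X w].
Proof. by rewrite -preimage_itvcy; exact: measurable_funPTI. Qed.

Lemma cdf_Ex y : \int[P]_w (X w <= y)%R%:R = g y.
Proof.
rewrite -[RHS]/(fine (g y)%:E) -Xg.
rewrite -[cdf X y]/(P (X @^-1` `]-oo, y])) preimage_itvNyc -Ex_indic//.
apply: eq_Rintegral => w _; rewrite indicE; congr (_%:R).
have [Xy|Xy] := leP (X w) y; first by rewrite mem_set.
by rewrite memNset//= leNgt Xy.
Qed.

(** The tail probability at [x] includes the atom at [x], whence the left limit
    of the distribution function. *)
Lemma left_limit_cdf x : left_limit g x = 1 - \int[P]_w (x <= X w)%R%:R.
Proof.
apply/cvg_lim => //.
have -> : \int[P]_w (x <= X w)%R%:R = fine (P [set w | x <= X w]).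
  rewrite -Ex_indic//; apply: eq_Rintegral => w _; rewrite indicE; congr (_%:R).
  have [Xy|Xy] := leP x (X w); first by rewrite mem_set.
  by rewrite memNset//= leNgt Xy.
set p := 1 - _.
have pE : p = fine (P [set w | X w < x]).
  rewrite /p (_ : [set w | X w < x] = ~` [set w | x <= X w]).
    by rewrite probability_setC// fineB ?fin_num_measure.
  by apply/seteqP; split => w /=; rewrite ltNge => /negP.
pose B k := [set w | X w <= x - k.+1%:R^-1].
have Bcvg : fine (P (B k)) @[k --> \oo] --> p.
  rewrite pE; apply: fine_cvg; rewrite fineK ?fin_num_measure//; last first.
    rewrite (_ : mkset _ = ~` [set w | x <= X w]); first exact: measurableC.
    by apply/seteqP; split => w /=; rewrite ltNge => /negP.
  rewrite (_ : [set w | X w < x] = \bigcup_k B k).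
    apply: nondecreasing_cvg_mu => [k||]; first exact: mle.
      by apply: bigcupT_measurable => k; exact: mle.
    move=> k k' kk'; apply/subsetPset => w /= /le_trans; apply.
    by rewrite lerD2l lerN2 lef_pV2 ?posrE// ler_nat.
  apply/seteqP; split => w /=.
    rewrite -subr_gt0 => /ltr_add_invr[k]; rewrite add0r => hk.
    by exists k => //; rewrite /B/= lerBrDr -lerBrDl ltW.
  by move=> [k _]; rewrite /B/= => /le_lt_trans; apply; rewrite ltrBlDr ltrDl invr_gt0.
apply/cvgrPdist_le => e e0.
have /cvgrPdist_le/(_ e e0)[K _ /(_ K (leqnn K))] := Bcvg.
rewrite ler_norml => /andP[_ hK].
near=> y.
have gE z : g z = fine (P [set w | X w <= z]).
  by rewrite -[g z]/(fine (g z)%:E) -Xg -preimage_itvNyc.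
have yx : y < x by near: y; exact: nbhs_left_lt.
have Ky : x - K.+1%:R^-1 <= y.
  by near: y; apply: nbhs_left_ge; rewrite ltrBlDr ltrDl invr_gt0.
have mlt : measurable [set w | X w < x].
  rewrite (_ : mkset _ = ~` [set w | x <= X w]); first exact: measurableC.
  by apply/seteqP; split => w /=; rewrite ltNge => /negP.
have gp : g y <= p.
  rewrite gE pE fine_le ?fin_num_measure// le_measure ?inE//.
  by move=> w /= /le_lt_trans; apply.
have Bg : fine (P (B K)) <= g y.
  rewrite gE fine_le ?fin_num_measure//; [exact: mle|].
  rewrite le_measure ?inE//; first exact: mle.
  by move=> w /= /le_trans; apply.
rewrite ger0_norm ?subr_ge0//; lra.
Unshelve. all: by end_near. Qed.

End left_limits.

Section variances.
Context {R : realType} {d : measure_display} {T : measurableType d}.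
Variable P : probability T R.

Lemma variance_Ex (f : T -> R) : bmeas f ->
  fine 'V_P[f] = \int[P]_w ((f w - \int[P]_v f v) ^+ 2).
Proof.
move=> bf; rewrite /variance unlock !expectation.unlock /Rintegral; congr fine.
Qed.

Lemma Ex_ae_eq (f g : T -> R) : bmeas f -> bmeas g ->
  {ae P, forall w, f w = g w} -> \int[P]_w f w = \int[P]_w g w.
Proof.
move=> [mf _] [mg _] fg; rewrite /Rintegral; congr fine.
apply: ae_eq_integral => //; [exact/measurable_EFinP|exact/measurable_EFinP|].
by apply: filterS fg => w fgw _; rewrite /= fgw.
Qed.

Lemma variance_ae_eq (f g : T -> R) : bmeas f -> bmeas g ->
  {ae P, forall w, f w = g w} -> fine 'V_P[f] = fine 'V_P[g].
Proof.
move=> bf bg fg; rewrite (variance_Ex bf) (variance_Ex bg) (Ex_ae_eq bf bg fg).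
apply: Ex_ae_eq.
- by apply/bmeasX/bmeasB => //; exact: bmeas_cst.
- by apply/bmeasX/bmeasB => //; exact: bmeas_cst.
- by apply: filterS fg => w ->.
Qed.

End variances.

Section no_common_atoms.
Context {R : realType} {d : measure_display} {T : measurableType d}.
Variables (P : probability T R) (X Y : {RV P >-> R}) (F G : cumulative R R).
Hypothesis XF : forall x, cdf X x = (F x)%:E.
Hypothesis YG : forall x, cdf Y x = (G x)%:E.

(** The events [Z <= x] and [x <= Z] cover the space and overlap in the atom. *)
Lemma cdf_left_limit_pmf (Z : {RV P >-> R}) (H : cumulative R R) x :
  (forall x, cdf Z x = (H x)%:E) -> H x - left_limit H x = pmf Z x.
Proof.
move=> ZH; rewrite (left_limit_cdf ZH) -(cdf_Ex ZH).
have ble : bmeas (fun w => (Z w <= x)%R%:R : R).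
  by apply: bmeas_natr; exact: measurable_fun_ler.
have bge : bmeas (fun w => (x <= Z w)%R%:R : R).
  by apply: bmeas_natr; exact: measurable_fun_ler.
transitivity (\int[P]_w ((Z w <= x)%R%:R + (x <= Z w)%R%:R - 1)).
  rewrite ExB; [|exact: bmeasD|exact: bmeas_cst].
  by rewrite ExD// Ex_cst opprB addrA.
rewrite /pmf -Ex_indic; last exact: measurable_funPTI.
apply: eq_Rintegral => w _; rewrite indicE.
have [Zx|Zx|Zx] := ltgtP (Z w) x.
- by rewrite memNset/= ?addr0 ?add0r ?subrr//; move=> E; rewrite E ltxx in Zx.
- by rewrite memNset/= ?addr0 ?add0r ?subrr//; move=> E; rewrite E ltxx in Zx.
- by rewrite mem_set// addrK.
Qed.

Lemma cdf_continuous_pmf0 (Z : {RV P >-> R}) (H : cumulative R R) x :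
  (forall x, cdf Z x = (H x)%:E) -> {for x, continuous H} -> pmf Z x = 0.
Proof.
move=> ZH cH; rewrite -(cdf_left_limit_pmf x ZH).
suff -> : left_limit H x = H x by rewrite subrr.
by apply/cvg_lim => //; exact: cvg_at_left_filter.
Qed.

(** The atoms of [Y] are countably many, and [X] charges none of them. *)
Lemma left_limit_ae_eq :
  (forall x, {for x, continuous F} \/ {for x, continuous G}) ->
  {ae P, forall w, G (X w) = left_limit G (X w)}.
Proof.
move=> FG; pose A := [set r | 0 < pmf Y r].
have cA : countable A by exact: pmf_gt0_countable.
have [f finj] : exists f : R -> nat, {in A &, injective f}.
  by apply/countable_injP: cA.
pose N k := \bigcup_(r in A `&` f @^-1` [set k]) (X @^-1` [set r]).
apply: (negligibleS (A := \bigcup_k N k)).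
  move=> w /= GXw; exists (f (X w)) => //; exists (X w) => //; split => //.
  rewrite /A/= lt0r pmf_ge0 andbT -(cdf_left_limit_pmf _ YG) subr_eq0.
  by apply/eqP => GX; apply: GXw.
apply: negligible_bigcup => k.
have [[r [Ar fr]]|noA] := pselect (exists r, A r /\ f r = k).
  have -> : N k = X @^-1` [set r].
    apply/seteqP; split=> [w [r' [Ar' fr'] /= Xr']|w Xw]; last by exists r.
    rewrite Xr'; apply: finj; rewrite ?inE//.
    by rewrite fr.
  have mXr : d.-measurable (X @^-1` [set r]).
    by apply: measurable_funPTI; exact: measurable_set1.
  exists (X @^-1` [set r]); split => //.
  have pX : pmf X r = 0.
    apply: cdf_continuous_pmf0 XF _; case: (FG r) => // cG.
    by move: Ar; rewrite /A/= (cdf_continuous_pmf0 YG cG) ltxx.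
  by have := congr1 EFin pX; rewrite /pmf fineK ?fin_num_measure.
have -> : N k = set0.
  by apply/seteqP; split => // w [r [Ar fr] _]; apply: noA; exists r.
exact: negligible_set0.
Qed.

End no_common_atoms.

(** Both sides are the Stieltjes integral with respect to the common
    distribution function. *)
Lemma same_law_Ex {R : realType} {d d' : measure_display}
    {T : measurableType d} {T' : measurableType d'}
    (P : probability T R) (P' : probability T' R)
    (X : {RV P >-> R}) (X' : {RV P' >-> R}) (g : cumulative R R) (f : R -> R) :
  (forall x, cdf X x = (g x)%:E) -> (forall x, cdf X' x = (g x)%:E) ->
  bmeas f -> (forall x, 0 <= f x) ->
  \int[P]_w f (X w) = \int[P']_w f (X' w).
Proof. by move=> Xg X'g bf f0; rewrite -(stieltjes_law Xg)// (stieltjes_law X'g). Qed.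

Theorem theorem4p1 (R : realType)
  (a : R -> R)
  (a_gt0 : forall t, 0 < t -> 0 < a t)
  (a_cvgy : a t @[t --> +oo] --> +oo)
  (a_small : a t / Num.sqrt t @[t --> +oo] --> 0)
  (m : nat -> nat)
  (m_gt0 : forall n, (0 < n)%N -> (0 < m n)%N)
  (lambda : R)
  (lambda01 : 0 < lambda < 1)
  (m_cvg : (m n)%:R / (m n + n)%:R @[n --> \oo] --> lambda)
  (F G : cumulativeBounded (0 : R) (1 : R))
  (d0 : measure_display) (T0 : measurableType d0) (P0 : probability T0 R)
  (X Y : {RV P0 >-> R})
  (X_cdf : forall x, cdf X x = (F x)%:E)
  (Y_cdf : forall x, cdf Y x = (G x)%:E)
  (d : nat -> measure_display) (T : forall n, measurableType (d n))
  (P : forall n, probability (T n) R)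
  (Xs : forall n, 'I_(m n) -> {RV (P n) >-> R})
  (Ys : forall n, 'I_n -> {RV (P n) >-> R})
  (Xs_iid : forall n, iid_with_cdf (Xs n) F)
  (Ys_iid : forall n, iid_with_cdf (Ys n) G)
  (XsYs_indep : forall n, independent_samples (Xs n) (Ys n)) :
  let N n : R := (m n * n)%:R / (m n + n)%:R in
  let Fm n (w : T n) : R -> R := ecdf (fun i => Xs n i w) in
  let Gn n (w : T n) : cumulative R R := ecdf (fun j => Ys n j w) in
  let Z n (w : T n) : R :=
    Num.sqrt (N n) / a (N n) *
      (stieltjes (Fm n w) (Gn n w) - stieltjes F G) in
  let speed n := a (N n) ^+ 2 in
  let vFY := fine 'V_P0[F \o Y] in
  let vGX := fine 'V_P0[G \o X] in
  let vGleftX := fine 'V_P0[left_limit G \o X] in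
  ((forall x, {for x, continuous F} \/ {for x, continuous G}) ->
     LDP (S := R^o) (@measurable _ R) P Z speed (wilcoxon_rate lambda vFY vGX)) /\
  LDP (S := R^o) (@measurable _ R) P Z speed (wilcoxon_rate lambda vFY vGleftX).
Proof.
move=> N Fm Gn Z speed vFY vGX vGleftX.
have bmeas_cdf (H : cumulative R R) (V : {RV P0 >-> R}) :
    (forall x, cdf V x = (H x)%:E) -> bmeas H /\ forall x, 0 <= H x <= 1.
  move=> VH; have H01 x : 0 <= H x <= 1.
    by rewrite -!lee_fin -VH cdf_ge0 cdf_le1.
  split => //; split.
    by apply: nondecreasing_measurable => //; exact: cumulative_is_nondecreasing.
  by exists 1 => x; have /andP[H0 H1] := H01 x; rewrite ger0_norm.
have [bF F01] := bmeas_cdf _ _ X_cdf.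
have [bG _] := bmeas_cdf _ _ Y_cdf.
pose h (z : R * R) : R := (z.1 <= z.2)%R%:R.
have bh : bmeas h.
  by apply: bmeas_natr; exact: measurable_fun_ler.
have h0 z : 0 <= h z by exact: ler0n.
have h_le1 z : h z <= 1 by rewrite /h lern1; case: (_ <= _).
pose h1 (x : R) := \int[P0]_w h (x, Y w).
have bhY : bmeas (fun z : R * T0 => h (z.1, Y z.2)).
  apply: (bmeas_comp bh); apply: measurable_fun_pair => //.
  exact: measurableT_comp.
have bh1 : bmeas h1 by exact: (@bmeas_Exl _ _ _ _ _ P0 _ bhY).
have h10 x : 0 <= h1 x by exact: Rintegral_ge0.
have h11 x : h1 x <= 1.
  by apply: Ex_le_cst => //; exact: (bmeas_sectionl bhY x).
pose theta := \int[P0]_w F (Y w).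
have bFY : bmeas (F \o Y) by exact: bmeas_comp_mfun.
have theta0 : 0 <= theta by apply: Rintegral_ge0 => w _; case/andP: (F01 (Y w)).
have theta1 : theta <= 1 by apply: Ex_le_cst => // w; case/andP: (F01 (Y w)).
have EhX : \int[P0]_w h1 (X w) = theta.
  have bhXY : bmeas (fun z : T0 * T0 => h (X z.1, Y z.2)).
    by apply: (bmeas_comp bh); apply: measurable_fun_pair; exact: measurableT_comp.
  rewrite (Ex_swap P0 P0 bhXY)//; apply: eq_Rintegral => w _.
  exact: cdf_Ex X_cdf (Y w).
have bge x : bmeas (fun y => h (x, y)).
  by apply: (bmeas_comp bh); exact: measurable_fun_pair.
have left_limitE x : left_limit G x = 1 - h1 x by exact: left_limit_cdf Y_cdf x.
have bleft : bmeas (left_limit G \o X).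
  rewrite (_ : _ \o _ = fun w => 1 - h1 (X w)).
    by apply: bmeasB; [exact: bmeas_cst|exact: bmeas_comp_mfun].
  by apply/funext => w /=; rewrite left_limitE.
(* The kernel projection is [1 - G (x-)], with the variance of [G (x-)]. *)
have main : LDP (S := R^o) (@measurable _ R) P Z speed
    (wilcoxon_rate lambda vFY vGleftX).
  have v1E : \int[P0]_w ((h1 (X w) - theta) ^+ 2) = vGleftX.
    rewrite /vGleftX (variance_Ex _ bleft); apply: eq_Rintegral => w _ /=.
    under [in RHS]eq_Rintegral do rewrite left_limitE.
    rewrite ExB; [|exact: bmeas_cst|exact: bmeas_comp_mfun].
    by rewrite Ex_cst EhX left_limitE -sqrrN; congr (_ ^+ 2); ring.
  have v2E : \int[P0]_w ((F (Y w) - theta) ^+ 2) = vFY.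
    by rewrite /vFY (variance_Ex _ bFY).
  have -> : Z = fun n w => Num.sqrt (N n) / a (N n) *
     (((m n)%:R * n%:R)^-1 *
        \sum_(i < m n) \sum_(j < n) h (Xs n i w, Ys n j w) - theta).
    apply: functional_extensionality_dep => n; apply/funext => w.
    rewrite /Z; congr (_ * (_ - _)).
      rewrite stieltjes_ecdf; first last.
      - by move=> t; rewrite /Fm /ecdf mulr_ge0 ?invr_ge0// sumr_ge0.
      - apply/bmeasZ/bmeas_sum => i _; apply: bmeas_natr.
        exact: measurable_fun_ler.
      rewrite /Fm /ecdf -mulr_sumr mulrA exchange_big/=; congr (_ * _).
      by rewrite invfM mulrC.
    apply: stieltjes_law => // x; by case/andP: (F01 x).
  apply: (@ustat_LDP R a m lambda a_gt0 a_cvgy a_small m_gt0 lambda01 m_cvg d T P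
    Xs Ys _ _ _ h h1 F theta vGleftX vFY) => //.
  - by move=> n; case: (Xs_iid n).
  - by move=> n; case: (Ys_iid n).
  - by case: bh.
  - by case: bh1.
  - by case: bF.
  - by move=> z; rewrite ger0_norm.
  - by move=> x; rewrite ger0_norm.
  - by move=> y; have /andP[F0 F1] := F01 y; rewrite ger0_norm.
  - by rewrite ger0_norm.
  - by move=> n i y; exact: cdf_Ex (proj2 (Xs_iid n) i) y.
  - move=> n j x.
    exact: (same_law_Ex (proj2 (Ys_iid n) j) Y_cdf (bge x) (fun y => h0 (x, y))).
  - move=> n i; rewrite -EhX.
    exact: (same_law_Ex (proj2 (Xs_iid n) i) X_cdf bh1 h10).
  - move=> n j; apply: (same_law_Ex (proj2 (Ys_iid n) j) Y_cdf bF) => x.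
    by case/andP: (F01 x).
  - move=> n i; rewrite -v1E.
    apply: (same_law_Ex (f := fun x => (h1 x - theta) ^+ 2)
      (proj2 (Xs_iid n) i) X_cdf) => [|x]; last exact: sqr_ge0.
    by apply/bmeasX/bmeasB => //; exact: bmeas_cst.
  - move=> n j; rewrite -v2E.
    apply: (same_law_Ex (f := fun x => (F x - theta) ^+ 2)
      (proj2 (Ys_iid n) j) Y_cdf) => [|x]; last exact: sqr_ge0.
    by apply/bmeasX/bmeasB => //; exact: bmeas_cst.
split => // FG.
suff -> : vGX = vGleftX by [].
apply: variance_ae_eq => //; first exact: bmeas_comp_mfun.
exact: (left_limit_ae_eq X_cdf Y_cdf FG).
Qed.
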